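(* Let $N$ and $M$ be II$_1$-factors. Then $\mathrm{Hom}(N,M^\infty)$ has cancellation, i.e. for all $[\rho],[\phi],[\psi]\in\mathrm{Hom}(N,M^\infty)$, $$[\rho]+[\phi]=[\rho]+[\psi]\ \Rightarrow\ [\phi]=[\psi].$$
   Context: $H$ is a separable infinite-dimensional Hilbert space. $M^\infty\subset B(H)\bar\otimes M$ is the algebraic ideal generated by the projections of finite trace. $\mathrm{Hom}(N,M^\infty)$ is the set of $*$-homomorphisms $\pi\colon N\to M^\infty$ (not necessarily unital, possibly zero) modulo conjugation by unitaries of $B(H)\bar\otimes M$: $[\pi_1]=[\pi_2]$ iff there is a unitary $u\in B(H)\bar\otimes M$ with $\pi_1=\mathrm{Ad}\,u\circ\pi_2$. Addition is defined by $[\phi]+[\psi]:=[\tilde\phi+\psi]$, where $\tilde\phi$ is a representative of $[\phi]$ with $\tilde\phi(1)\perp\psi(1)$ (such a representative always exists, and the sum is well defined). *)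

(* Defs.v *)
(* Hilbert spaces are complex, over R[i] for an arbitrary R : realType. *)
From HB Require Import structures.
From mathcomp Require Import all_boot all_order all_algebra.
From mathcomp Require Import sesquilinear complex.
From mathcomp Require Import all_classical all_reals all_analysis.

Set Implicit Arguments.
Unset Strict Implicit.
Unset Printing Implicit Defensive.

Import Order.TTheory GRing.Theory Num.Theory.
Import numFieldNormedType.Exports.

Local Open Scope classical_set_scope.
Local Open Scope ring_scope.

(* The inner product is linear in its first argument. *)
HB.mixin Record isHilbert (R : realType) V
    of CompleteNormedModule R[i] V := {
  dot : {dot V for Num.conj};
  dot_norm : forall x : V, dot x x = `|x| ^+ 2
}.

#[short(type="hilbertType")]
HB.structure Definition Hilbert (R : realType) :=
  {V of isHilbert R V & CompleteNormedModule R[i] V}.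

Section LinearSpan.
Context {C : nzRingType} {V : lmodType C}.

Definition lin_span (S : set V) : set V :=
  [set v | exists n (a : 'I_n -> C) (b : 'I_n -> V),
    (forall i, S (b i)) /\ v = \sum_i a i *: b i].

Definition infinite_dimensional (A : set V) : Prop :=
  forall n (b : 'I_n -> V), ~ (A `<=` lin_span (range b)).

End LinearSpan.

Definition separable_space (T : topologicalType) : Prop :=
  exists2 D : set T, countable D & dense D.

Section Operators.
Context {R : realType}.

(* Operators are plain functions; V -> W carries the pointwise vector space
   structure, composition is \o and the identity operator is id. *)
Definition bounded_op (V W : hilbertType R) : set (V -> W) :=
  [set T | linear T /\ continuous T].

(* The adjoint of a bounded operator exists and is unique (Riesz); on other
   functions adj may be the junk value 0. *)
Definition adj (V W : hilbertType R) (T : V -> W) : W -> V :=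
  xget 0 [set S | forall v w, dot (T v) w = dot v (S w)].

Context {K : hilbertType R}.
Implicit Types (A M I : set (K -> K)) (T p u : K -> K).

Definition commutant A : set (K -> K) :=
  [set T | bounded_op T /\ forall S, A S -> T \o S = S \o T].

Definition von_neumann_algebra M : Prop :=
  [/\ M `<=` bounded_op (V:=K) (W:=K),
      forall T, M T -> M (adj T)
    & commutant (commutant M) = M].

Definition factor_algebra M : Prop :=
  von_neumann_algebra M /\
  M `&` commutant M = [set T | exists c : R[i], T = c *: id].

Definition projection_op p : Prop := p \o p = p /\ adj p = p.

Definition unitary_op u : Prop := u \o adj u = id /\ adj u \o u = id.

(* On R[i], x <= y means that y - x is real and nonnegative. *)
Definition op_le S T : Prop := forall v : K, dot (S v) v <= dot (T v) v.

Definition op_lub M (D : set (K -> K)) T : Prop :=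
  [/\ M T, forall S, D S -> op_le S T
    & forall U, M U -> (forall S, D S -> op_le S U) -> op_le T U].

Definition op_directed (D : set (K -> K)) : Prop :=
  D !=set0 /\
  forall S T, D S -> D T -> exists2 U, D U & op_le S U /\ op_le T U.

(* tau is only relevant on M *)
Record faithful_normal_tracial_state M (tau : (K -> K) -> R[i]) : Prop := {
  trace_linear : forall a S T, M S -> M T ->
    tau (a *: S + T) = a * tau S + tau T;
  trace_pos : forall T, M T -> 0 <= tau (adj T \o T);
  trace_unit : tau id = 1;
  trace_comm : forall S T, M S -> M T -> tau (S \o T) = tau (T \o S);
  trace_faithful : forall T, M T -> tau (adj T \o T) = 0 -> T = 0;
  trace_normal : forall (D : set (K -> K)) T,
    D `<=` [set S | M S /\ op_le 0 S] -> op_directed D -> op_lub M D T ->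
    forall c, (forall S, D S -> tau S <= c) -> tau T <= c
}.

Definition II1_factor M : Prop :=
  [/\ factor_algebra M, infinite_dimensional M
    & exists tau, faithful_normal_tracial_state M tau].

Definition two_sided_ideal A I : Prop :=
  [/\ I `<=` A, I 0, forall S T, I S -> I T -> I (S + T)
    & forall S T, A S -> I T -> I (S \o T) /\ I (T \o S)].

End Operators.

Section Amplification.
Context {R : realType} {H K L : hilbertType R}.

(* t exhibits L as the Hilbert space tensor product of H and K, t h k being
   the elementary tensor of h and k. *)
Record hilbert_tensor (t : H -> K -> L) : Prop := {
  tensor_linearl : forall k, linear (t ^~ k);
  tensor_linearr : forall h, linear (t h);
  tensor_dot : forall h h' k k', dot (t h k) (t h' k') = dot h h' * dot k k';
  tensor_dense : dense (lin_span [set v | exists h k, v = t h k])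
}.

Definition orthonormal_basis (e : nat -> H) : Prop :=
  (forall i j, dot (e i) (e j) = (i == j)%:R) /\ dense (lin_span (range e)).

Variables (t : H -> K -> L) (M : set (K -> K)) (tau : (K -> K) -> R[i]).

Definition tensor_op (x : H -> H) (y : K -> K) (T : L -> L) : Prop :=
  forall h k, T (t h k) = t (x h) (y k).

(* The von Neumann tensor product of B(H) and M. *)
Definition amplification : set (L -> L) :=
  commutant (commutant
    [set T | bounded_op T /\
      exists x y, [/\ bounded_op x, M y & tensor_op x y T]]).

(* The trace of T >= 0 for the tensor product of Tr and tau: the sum of the
   values of tau at the diagonal entries of T in the orthonormal basis e. *)
Definition amplified_trace (e : nat -> H) (T : L -> L) : \bar R :=
  (\sum_(0 <= i <oo) (complex.Re (tau (adj (t (e i)) \o T \o t (e i))))%:E)%E.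

Definition finite_trace_projection : set (L -> L) :=
  [set p | [/\ amplification p, projection_op p &
    exists2 e, orthonormal_basis e & (amplified_trace e p < +oo)%E]].

Definition finite_trace_ideal : set (L -> L) :=
  smallest (two_sided_ideal amplification) finite_trace_projection.

End Amplification.

Section HomSpace.
Context {R : realType} {G L : hilbertType R}.
Variables (N : set (G -> G)) (A I : set (L -> L)).
Implicit Types pi phi psi chi : (G -> G) -> (L -> L).

Record star_hom pi : Prop := {
  star_hom_in : forall x, N x -> I (pi x);
  star_hom_linear : forall a x y, N x -> N y ->
    pi (a *: x + y) = a *: pi x + pi y;
  star_hom_mul : forall x y, N x -> N y -> pi (x \o y) = pi x \o pi y;
  star_hom_adj : forall x, N x -> pi (adj x) = adj (pi x)
}.

Definition conj_equiv pi1 pi2 : Prop :=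
  exists u, [/\ A u, unitary_op u
    & forall x, N x -> pi1 x = u \o pi2 x \o adj u].

Definition hom_class pi : set ((G -> G) -> (L -> L)) :=
  [set pi' | star_hom pi' /\ conj_equiv pi' pi].

Definition hom_space : set (set ((G -> G) -> (L -> L))) :=
  [set hom_class pi | pi in star_hom].

(* The class of phi + psi for representatives phi of a and psi of b with
   orthogonal units. That class does not depend on the representatives, so the
   union over all of them is a single class. *)
Definition hom_add (a b : set ((G -> G) -> (L -> L))) :
    set ((G -> G) -> (L -> L)) :=
  [set chi | exists phi psi,
    [/\ a phi, b psi, phi id \o psi id = 0 & hom_class (phi + psi) chi]].

End HomSpace.

(* Main.v *)
(* Write rho + phi = rho' + psi' =: pi after conjugation, with rho' = Ad w o rho.
   In the relative commutant of pi(N), a finite von Neumann algebra with unit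
   P = pi(1), the projections p = rho(1) and q = rho'(1) are equivalent through
   w p, and cancellation amounts to extending w p to a unitary of that algebra.
   By Zorn's lemma there is a maximal partial isometry x between the complements
   P - p and P - q. With V = w p + x, maximality makes (P - V V^* ) V^*^n
   (P - V^* V) vanish for all n, so the projections V^*^n (P - V^* V) V^n are
   mutually orthogonal and equivalent. They lie below P, which has finite trace,
   hence V^* V = P = V V^*, and V + (1 - P) conjugates phi to psi'.

   The sum is never empty, because finite projections p, q of the infinite factor
   B(H) (x) M are contained in a finite projection r, and p is equivalent to a
   subprojection of 1 - r; exchanging the two is a unitary.

   All partial isometries come from isometric linear relations: such a relation
   in L x L extends by continuity to a partial isometry, which commutes with
   every operator that preserves the relation together with its adjoint. *)
Require Import Defs.
From HB Require Import structures.
From mathcomp Require Import all_boot all_order all_algebra.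
From mathcomp Require Import sesquilinear complex ring lra.
From mathcomp Require Import all_classical all_reals all_analysis.

Set Implicit Arguments.
Unset Strict Implicit.
Unset Printing Implicit Defensive.

Import Order.TTheory GRing.Theory Num.Theory.
Import numFieldNormedType.Exports.

Local Open Scope classical_set_scope.
Local Open Scope ring_scope.
Local Open Scope complex_scope.

(** * Hilbert spaces and bounded operators *)

(** The relative commutant of [pi(N)] is in general not a factor, so its projections [P - p] and
    [P - q] need not be comparable. Maximality of [x] gives something weaker: no element [y] of the
    relative commutant joins the two leftovers, that is [(f - x * star x) * y * (e - star x * x) =
    0] with [e = P - p] and [f = P - q]. Taking [y = star V ^+ n] says that [star V] carries the
    defect [P - star V * V] into the final space of [V] again and again, where it stays isometric;
    hence infinitely many equivalent copies of the defect. In [B(H) (x) M] itself, factoriality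
    turns the same relation into the vanishing of one leftover. Spectral theory is replaced by one
    square root, obtained by iteration: it gives moduli, and pairs [(Q z, T z)] with [Q] the modulus
    of [T] form an isometric relation, which is the polar decomposition of [T]. Finiteness is
    handled through [star X * X], as for Hilbert-Schmidt operators, because positivity is then
    visible and [star X * X] and [X * star X] can be exchanged under the trace. *)

Section ComplexReal.
Context {R : realType}.

(** Norms over [R[i]] take values in [R[i]], whose order is partial; [cabs], like [hnorm] below,
    moves them to [R], where estimates are totally ordered. *)
Definition cabs (a : R[i]) : R := complex.Re `|a|.

Lemma cabsE a : `|a| = (cabs a)%:C.
Proof. by rewrite /cabs RRe_real// ger0_real. Qed.

Lemma realCD (x y : R) : (x + y)%:C = x%:C + y%:C.
Proof. exact: rmorphD. Qed.
Lemma realCM (x y : R) : (x * y)%:C = x%:C * y%:C.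
Proof. exact: rmorphM. Qed.
Lemma realCX (x : R) n : (x ^+ n)%:C = x%:C ^+ n.
Proof. exact: rmorphXn. Qed.

Lemma cabsM a b : cabs (a * b) = cabs a * cabs b.
Proof. by apply: complexI; rewrite realCM -!cabsE normrM. Qed.

Lemma cabs_ge0 a : 0 <= cabs a.
Proof. by rewrite -ler0c -cabsE. Qed.

Lemma cabs_real (x : R) : cabs x%:C = `|x|.
Proof. by apply: complexI;
  rewrite -cabsE normc_def /= expr0n addr0 sqrtr_sqr. Qed.

Lemma cabs_sqr a : cabs a ^+ 2 = complex.Re a ^+ 2 + complex.Im a ^+ 2.
Proof. by apply: complexI; rewrite realCX -cabsE add_Re2_Im2. Qed.

Lemma Re_le_cabs (z : R[i]) : complex.Re z <= cabs z.
Proof. by rewrite -lecR -cabsE (le_trans _ (normc_ge_Re z))// lecR ler_norm.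
  Qed.

Lemma ler_cabsD (a b : R[i]) : cabs (a + b) <= cabs a + cabs b.
Proof. by rewrite -lecR realCD -!cabsE ler_normD. Qed.

Lemma cabs_opp (a : R[i]) : cabs (- a) = cabs a.
Proof. by rewrite /cabs normrN. Qed.

Lemma cabs_eq0 (a : R[i]) : cabs a = 0 -> a = 0.
Proof. by move=> a0; apply: normr0_eq0; rewrite cabsE a0. Qed.

End ComplexReal.

Section InnerProduct.
Context {R : realType} {V : hilbertType R}.
Implicit Types x y z : V.

Lemma dotC x y : dot x y = (dot y x)^*.
Proof. by rewrite hermC /= expr0 mul1r. Qed.

Lemma dot_eq0C x y : dot x y = 0 -> dot y x = 0.
Proof. by rewrite dotC => /eqP; rewrite conjC_eq0 => /eqP. Qed.

Lemma dotDl x y z : dot (x + y) z = dot x z + dot y z.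
Proof. exact: linearDl. Qed.
Lemma dotDr x y z : dot x (y + z) = dot x y + dot x z.
Proof. exact: linearDr. Qed.
Lemma dotNl x y : dot (- x) y = - dot x y.
Proof. exact: linearNl. Qed.
Lemma dotNr x y : dot x (- y) = - dot x y.
Proof. exact: linearNr. Qed.
Lemma dotBl x y z : dot (x - y) z = dot x z - dot y z.
Proof. exact: linearBl. Qed.
Lemma dotBr x y z : dot x (y - z) = dot x y - dot x z.
Proof. exact: linearBr. Qed.
Lemma dot0l y : dot 0 y = 0.
Proof. exact: linear0l. Qed.
Lemma dot0r x : dot x 0 = 0.
Proof. exact: linear0r. Qed.
Lemma dotZl a x y : dot (a *: x) y = a * dot x y.
Proof. by rewrite linearZl_LR. Qed.
Lemma dotZr a x y : dot x (a *: y) = a^* * dot x y.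
Proof. by rewrite linearZr_LR. Qed.

Lemma dot_suml n (a : 'I_n -> V) y : dot (\sum_i a i) y = \sum_i dot (a i) y.
Proof. exact: linear_sumlz. Qed.

Definition hnorm x : R := complex.Re `|x|.

Lemma hnormE x : `|x| = (hnorm x)%:C.
Proof. by rewrite /hnorm RRe_real// ger0_real. Qed.

Lemma hnorm_ge0 x : 0 <= hnorm x.
Proof. by rewrite -ler0c -hnormE. Qed.

Lemma hnorm0 : hnorm 0 = 0.
Proof. by rewrite /hnorm normr0. Qed.

Lemma hnorm_eq0 x : hnorm x = 0 -> x = 0.
Proof. by move=> x0; apply/eqP; rewrite -normr_eq0 hnormE x0. Qed.

Lemma dotE x : dot x x = (hnorm x ^+ 2)%:C.
Proof. by rewrite dot_norm hnormE rmorphXn. Qed.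

Lemma Re_dot x : complex.Re (dot x x) = hnorm x ^+ 2.
Proof. by rewrite dotE. Qed.

Lemma dot_eq0 x : dot x x = 0 -> x = 0.
Proof.
by rewrite dotE => /complexI/eqP; rewrite sqrf_eq0 => /eqP /hnorm_eq0.
Qed.

Lemma dot_inj x y : (forall z, dot x z = dot y z) -> x = y.
Proof.
by move=> xy; apply/subr0_eq/dot_eq0; rewrite dotBl xy subrr.
Qed.

Lemma ler_hnormD x y : hnorm (x + y) <= hnorm x + hnorm y.
Proof. by rewrite -lecR rmorphD /= -!hnormE ler_normD. Qed.

Lemma hnorm_opp x : hnorm (- x) = hnorm x.
Proof. by rewrite /hnorm normrN. Qed.

Lemma hdistC x y : hnorm (x - y) = hnorm (y - x).
Proof. by rewrite -hnorm_opp opprB. Qed.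

Lemma hnormZ a x : hnorm (a *: x) = cabs a * hnorm x.
Proof.
by apply: (@complexI R); rewrite -[LHS]hnormE normrZ cabsE hnormE -realCM.
Qed.

Lemma hnorm_sqrD x y :
  hnorm (x + y) ^+ 2 = hnorm x ^+ 2 + hnorm y ^+ 2 + 2 * complex.Re (dot x y).
Proof.
rewrite -!Re_dot dotDl !dotDr !raddfD /= (dotC y x).
by case: (dot x y) => a b /=; ring.
Qed.

Lemma hnorm_sqrB x y :
  hnorm (x - y) ^+ 2 = hnorm x ^+ 2 + hnorm y ^+ 2 - 2 * complex.Re (dot x y).
Proof. by rewrite hnorm_sqrD hnorm_opp dotNr raddfN /= mulrN. Qed.

Lemma parallelogram x y :
  hnorm (x + y) ^+ 2 + hnorm (x - y) ^+ 2 = 2 * (hnorm x ^+ 2 + hnorm y ^+ 2).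
Proof. by rewrite hnorm_sqrD hnorm_sqrB; ring. Qed.

Lemma pythagoras x y : dot x y = 0 ->
  hnorm (x + y) ^+ 2 = hnorm x ^+ 2 + hnorm y ^+ 2.
Proof. by move=> xy; rewrite hnorm_sqrD xy /= mulr0 addr0. Qed.

(** Subtracting a small positive multiple of [dot x y *: y] would shorten [x] if [dot x y] were
    nonzero. *)
Lemma dot_eq0_min x y :
  (forall a, hnorm x <= hnorm (x - a *: y)) -> dot x y = 0.
Proof.
move=> xmin; set c := dot x y.
pose n := hnorm y ^+ 2.
have n_ge0 : 0 <= n by rewrite exprn_ge0// hnorm_ge0.
(* Any positive [s] with [s * n < 2] yields the contradiction; the added 1 covers [y = 0]. *)
pose s : R := (n + 1)^-1.
have s_gt0 : 0 < s by rewrite invr_gt0; lra.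
have := xmin (s%:C * c).
rewrite -(ler_pXn2r (ltn0Sn 1)) ?nnegrE ?hnorm_ge0// hnorm_sqrB.
rewrite hnormZ exprMn dotZr.
set k := complex.Re c ^+ 2 + complex.Im c ^+ 2.
have -> : cabs (s%:C * c) ^+ 2 = s ^+ 2 * k.
  by rewrite cabsM cabs_real gtr0_norm// exprMn cabs_sqr.
have -> : complex.Re ((s%:C * c)^* * dot x y) = s * k.
  by rewrite -/c /k; case: (c) => u v /=; ring.
rewrite -/n => H.
have k_ge0 : 0 <= k by rewrite addr_ge0// sqr_ge0.
have sn : s * n <= 1.
  by rewrite mulrC ler_pdivrMr ?mul1r; lra.
have H2 : 2 * (s * k) <= s * k * (s * n) by lra.
have H3 : s * k * (s * n) <= s * k * 1.
  by apply: ler_wpM2l => //; rewrite mulr_ge0// ltW.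
have sk : s * k <= 0 by lra.
have k0 : k = 0.
  by apply/eqP; rewrite eq_le k_ge0 andbT -(pmulr_rle0 _ s_gt0).
move: k0; rewrite /k; case: (c) => u v /= /eqP.
by rewrite paddr_eq0 ?sqr_ge0// !sqrf_eq0 => /andP[/eqP-> /eqP->].
Qed.

Lemma cauchy_schwarz x y : cabs (dot x y) <= hnorm x * hnorm y.
Proof.
have [->|y0] := eqVneq y 0.
  by rewrite dot0r /cabs normr0 mulr_ge0 ?hnorm_ge0.
have ny : dot y y != 0 by apply: contra_neq y0 => /dot_eq0.
pose c := dot x y / dot y y.
have cE : c * dot y y = dot x y by rewrite /c divfK.
have o : dot (c *: y) (x - c *: y) = 0.
  rewrite dotBr !dotZl dotZr (dotC y x) -cE [in (_ * _)^*]mulrC.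
  by rewrite rmorphM /= -(dotC y y) [_ * c^*]mulrC subrr.
have := pythagoras o; rewrite addrC subrK => xE.
have : hnorm (c *: y) ^+ 2 <= hnorm x ^+ 2.
  by rewrite xE lerDl exprn_ge0// hnorm_ge0.
rewrite ler_pXn2r ?nnegrE ?hnorm_ge0// => /(ler_wpM2r (hnorm_ge0 y)).
apply: le_trans; rewrite hnormZ -mulrA -expr2 -cE cabsM dotE cabs_real.
by rewrite ger0_norm// exprn_ge0// hnorm_ge0.
Qed.

End InnerProduct.

Section Limits.
Context {R : realType} {V : hilbertType R}.
Implicit Types (u v : nat -> V) (x y : V).

Lemma hcvgP u x : u @ \oo --> x <->
  forall e : R, 0 < e -> exists N, forall n, (N <= n)%N -> hnorm (u n - x) < e.
Proof.
split=> [/cvgrPdist_lt ux e e0|ux].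
  have e0' : 0 < e%:C by rewrite ltcR.
  have [N _ H] := ux _ e0'; exists N => n Nn.
  by rewrite -ltcR -hnormE distrC; exact: H.
apply/cvgrPdist_lt => e e0.
have eE : e = (complex.Re e)%:C by rewrite RRe_real// gtr0_real.
rewrite eE ltcR in e0; have [N H] := ux _ e0.
exists N => // n /= Nn; rewrite distrC hnormE eE ltcR; exact: H.
Qed.

Lemma hcauchy_cvg u :
  (forall e : R, 0 < e -> exists N, forall m n, (N <= m)%N -> (N <= n)%N ->
     hnorm (u m - u n) < e) ->
  exists x, u @ \oo --> x.
Proof.
move=> uC; suff : cvg (u @ \oo) by move=> ?; exists (lim (u @ \oo)).
apply: cauchy_cvg; apply: cauchy_exP => e e0.
have eE : e = (complex.Re e)%:C by rewrite RRe_real// gtr0_real.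
rewrite eE ltcR in e0; have [N H] := uC _ e0.
exists (u N), N => // n /= Nn; rewrite -ball_normE /= hnormE eE ltcR.
exact: H.
Qed.

Lemma hcvg_unique u x y : u @ \oo --> x -> u @ \oo --> y -> x = y.
Proof. by move=> ux; apply: (cvg_unique _ ux); exact: norm_hausdorff. Qed.

Lemma hcvgD u v x y : u @ \oo --> x -> v @ \oo --> y ->
  (fun n => u n + v n) @ \oo --> x + y.
Proof. exact: cvgD. Qed.

Lemma hcvgZ a u x : u @ \oo --> x -> (fun n => a *: u n) @ \oo --> a *: x.
Proof. by move=> ux; apply: cvgZr. Qed.

Lemma hcvg_cst x : (fun=> x) @ \oo --> x.
Proof. exact: cvg_cst. Qed.

End Limits.

Section DotLimits.
Context {R : realType}.
Implicit Types V W : hilbertType R.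

Lemma hcvg_norm V (u : nat -> V) x :
u @ \oo --> x -> (fun n => hnorm (u n)) @ \oo --> hnorm x.
Proof.
move=> /hcvgP ux; apply/cvgrPdist_lt => e /ux[N H]; exists N => // n /= Nn.
apply: le_lt_trans (H _ Nn).
have := ler_hnormD (x - u n) (u n); have := ler_hnormD (u n - x) x.
by rewrite !subrK (hdistC x) => ? ?; rewrite ler_norml; apply/andP; split; lra.
Qed.

Lemma hcvg_dot_dist V (u v : nat -> V) x y : u @ \oo --> x -> v @ \oo --> y ->
  exists2 e : nat -> R, e @ \oo --> (0 : R) &
    forall n, cabs (dot (u n) (v n) - dot x y) <= e n.
Proof.
move=> ux vy.
exists (fun n => hnorm (u n - x) * hnorm (v n) + hnorm x * hnorm (v n - y)).
  have cst (z : V) : (fun=> z) @ \oo --> z by exact: cvg_cst.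
  have ux0 : (fun n => hnorm (u n - x)) @ \oo --> hnorm (x - x).
    by apply: hcvg_norm; apply: cvgB.
  have vy0 : (fun n => hnorm (v n - y)) @ \oo --> hnorm (y - y).
    by apply: hcvg_norm; apply: cvgB.
  have -> : (0 : R) = hnorm (x - x) * hnorm y + hnorm x * hnorm (y - y).
    by rewrite !subrr hnorm0 mul0r mulr0 addr0.
  apply: cvgD; first by apply: cvgM => //; exact: hcvg_norm.
  by apply: cvgM => //; exact: cvg_cst.
move=> n.
have -> : dot (u n) (v n) - dot x y = dot (u n - x) (v n) + dot x (v n - y).
  by rewrite dotBl dotBr addrA subrK.
by apply: le_trans (ler_cabsD _ _) _; apply: lerD; exact: cauchy_schwarz.
Qed.

(** Both sides stay within real null sequences of their limits. This carries identities from a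
    relation to its closure. *)
Lemma hcvg_dot_eq V W (u v : nat -> V) (u' v' : nat -> W) x y x' y' :
  u @ \oo --> x -> v @ \oo --> y -> u' @ \oo --> x' -> v' @ \oo --> y' ->
  (forall n, dot (u n) (v n) = dot (u' n) (v' n)) -> dot x y = dot x' y'.
Proof.
move=> ux vy ux' vy' E.
have [e e0 He] := hcvg_dot_dist ux vy.
have [f f0 Hf] := hcvg_dot_dist ux' vy'.
apply/subr0_eq/cabs_eq0/eqP; rewrite eq_le cabs_ge0 andbT.
rewrite -[X in _ <= X]addr0.
apply: (ler_cvg_to (cvg_cst _) (cvgD e0 f0)); apply: nearW => n /=.
have -> : dot x y - dot x' y' =
    - (dot (u n) (v n) - dot x y) + (dot (u' n) (v' n) - dot x' y').
  by rewrite E opprB addrA subrK.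
by apply: le_trans (ler_cabsD _ _) _; rewrite cabs_opp; exact: lerD.
Qed.

End DotLimits.

(** * Projection onto the closure of a subspace *)

Section Projection.
Context {R : realType} {V : hilbertType R}.
Implicit Types (D : set V) (x y z p : V) (u v : nat -> V).

Definition subspace D : Prop :=
  D 0 /\ forall (a : R[i]) x y, D x -> D y -> D (a *: x + y).

Lemma subspaceD D x y : subspace D -> D x -> D y -> D (x + y).
Proof. by move=> [_ DD] Dx Dy; rewrite -[x]scale1r; exact: DD. Qed.

Lemma subspaceZ D a x : subspace D -> D x -> D (a *: x).
Proof. by move=> [D0 DD] Dx; rewrite -[_ *: x]addr0; exact: DD. Qed.

Lemma projection_exists D z : subspace D -> exists p u,
  [/\ forall n, D (u n), u @ \oo --> p & forall y, D y -> dot (z - p) y = 0].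
Proof.
move=> Dsub.
pose E := [set hnorm (z - x) ^+ 2 | x in D].
have Einf : has_inf E.
  split; first by exists (hnorm (z - 0) ^+ 2), 0 => //; case: Dsub.
  by exists 0 => _ [x _ <-]; rewrite exprn_ge0// hnorm_ge0.
pose d := inf E.
have dmin x : D x -> d <= hnorm (z - x) ^+ 2.
  by move=> Dx; apply: ge_inf; [case: Einf|exists x].
have uP n : exists x, D x /\ hnorm (z - x) ^+ 2 < d + n.+1%:R^-1.
  have n0 : (0 : R) < n.+1%:R^-1 by rewrite invr_gt0.
  have [_ [x Dx <-] H] := inf_adherent n0 Einf.
  by exists x.
have [u /all_and2[Du uz]] := choice uP.
have [p up] : exists p, u @ \oo --> p.
  apply: hcauchy_cvg => e e0.
  (* Two squared distances below [d + e ^+ 2 / 4], with the midpoint at squared distance at least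
     [d], leave less than [e ^+ 2] for the difference. *)
  have e2 : 0 < e ^+ 2 / 4 by rewrite divr_gt0 ?exprn_gt0.
  have [N] : exists N : nat, (N.+1%:R^-1 : R) < e ^+ 2 / 4.
    exists (Num.truncn (e ^+ 2 / 4)^-1); rewrite invf_plt ?posrE//.
    exact: truncnS_gt.
  move=> HN; exists N => m n Nm Nn.
  have b k : (N <= k)%N -> hnorm (z - u k) ^+ 2 < d + e ^+ 2 / 4.
    move=> Nk; apply: lt_le_trans (uz k) _; rewrite lerD2l.
    apply: le_trans (ltW HN); rewrite lef_pV2 ?posrE//.
    by rewrite ler_nat ltnS.
  have := parallelogram (z - u m) (z - u n).
  have -> : z - u m - (z - u n) = - (u m - u n).
    by rewrite !opprB addrC addrA subrK.
  have -> : z - u m + (z - u n) = 2 *: (z - 2^-1 *: (u m + u n)).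
    rewrite scalerBr scalerA divff// scale1r.
    by rewrite scaler_nat mulr2n opprD addrACA.
  rewrite hnorm_opp hnormZ.
  have -> : cabs (2 : R[i]) = 2 by rewrite /cabs normr_nat.
  rewrite exprMn => PE.
  have Dmn : D (2^-1 *: (u m + u n)).
    by apply: subspaceZ => //; apply: subspaceD.
  have := dmin _ Dmn; have := b _ Nm; have := b _ Nn => b1 b2 b3.
  rewrite -(ltr_pXn2r (ltn0Sn 1)) ?nnegrE ?hnorm_ge0 ?(ltW e0)//.
  move: PE b1 b2 b3; set A := hnorm _ ^+ 2; set B := hnorm _ ^+ 2.
  by set C := hnorm _ ^+ 2; set F := hnorm _ ^+ 2; rewrite expr2; lra.
exists p, u; split=> // y Dy; apply: dot_eq0_min => a.
(* The point [p + x] may lie outside [D], but it is the limit of the points [u n + x] of [D]. *)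
have pd x : D x -> d <= hnorm (z - p - x) ^+ 2.
  move=> Dx.
  have : (fun n => hnorm (z - u n - x)) @ \oo --> hnorm (z - p - x).
    apply: hcvg_norm; apply: cvgB; last exact: cvg_cst.
    by apply: cvgB => //; exact: cvg_cst.
  move=> H; have H2 := cvgM H H; rewrite expr2.
  have H3 : (fun=> d) @ \oo --> d by exact: cvg_cst.
  apply: (ler_cvg_to H3 (H2 _)); apply: nearW => n /=;
    rewrite -expr2 -addrA -opprD.
  by apply: dmin; apply: subspaceD.
have dp : hnorm (z - p) ^+ 2 <= d.
  have H : (fun n => hnorm (z - u n)) @ \oo --> hnorm (z - p).
    by apply: hcvg_norm; apply: cvgB => //; exact: cvg_cst.
  have H2 := cvgM H H; rewrite expr2.
  have H3 : (fun n => d + n.+1%:R^-1) @ \oo --> d + (0 : R).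
    by apply: cvgD; [exact: cvg_cst|exact: cvg_harmonic].
  rewrite -[d]addr0; apply: ler_cvg_to (H2 _) H3 _; apply: nearW => n.
  by rewrite /= -expr2 ltW.
rewrite -(ler_pXn2r (ltn0Sn 1)) ?nnegrE ?hnorm_ge0//.
by apply: le_trans dp _; apply: pd; apply: subspaceZ.
Qed.

End Projection.

Section BoundedOperators.
Context {R : realType}.
Implicit Types U V W : hilbertType R.

Lemma linear_op0 V W (T : V -> W) : linear T -> T 0 = 0.
Proof.
move=> Tl; have := Tl (-1) 0 0.
by rewrite scaler0 addr0 scaleN1r addNr.
Qed.

Lemma linear_opD V W (T : V -> W) x y : linear T -> T (x + y) = T x + T y.
Proof. by move=> Tl; have := Tl 1 x y; rewrite !scale1r. Qed.

Lemma linear_opZ V W (T : V -> W) a x : linear T -> T (a *: x) = a *: T x.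
Proof. by move=> Tl; have := Tl a x 0; rewrite (linear_op0 Tl) !addr0. Qed.

Lemma linear_opN V W (T : V -> W) x : linear T -> T (- x) = - T x.
Proof. by move=> Tl; rewrite -scaleN1r linear_opZ// scaleN1r. Qed.

Lemma linear_opB V W (T : V -> W) x y : linear T -> T (x - y) = T x - T y.
Proof. by move=> Tl; rewrite linear_opD// linear_opN. Qed.

Lemma linear_op_sum V W (T : V -> W) n (x : 'I_n -> V) : linear T ->
  T (\sum_i x i) = \sum_i T (x i).
Proof.
move=> Tl; apply: (big_morph T) => [y z|]; first exact: linear_opD.
exact: linear_op0.
Qed.

Lemma bounded_opP V W (T : V -> W) : bounded_op T <->
  linear T /\ exists2 c : R, 0 < c & forall v, hnorm (T v) <= c * hnorm v.
Proof.
split=> [[Tl Tc]|[Tl [c c0 Tc]]]; split=> //.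
  pose f : {linear V -> W} := HB.pack T (GRing.isLinear.Build _ _ _ _ T Tl).
  have := @linear_bounded_continuous _ _ _ f.
  move=> [_ /(_ Tc)] /linear_boundedP [M [Mreal MP]].
  pose c := `|complex.Re M| + 1.
  have c0 : 0 < c by rewrite ltr_pwDr.
  exists c => // v; rewrite -lecR realCM -!hnormE.
  apply: (MP c%:C); rewrite -(RRe_real Mreal) ltcR /c.
  by rewrite (le_lt_trans (ler_norm _))// ltrDl.
move=> x; apply/cvgrPdist_lt => e e0.
have eE : e = (complex.Re e)%:C by rewrite RRe_real// gtr0_real.
rewrite eE ltcR in e0.
have e1 : 0 < (complex.Re e / c)%:C by rewrite ltcR divr_gt0.
near=> y; rewrite -linear_opB// hnormE eE ltcR.
apply: le_lt_trans (Tc _) _; rewrite mulrC -ltr_pdivlMr// -ltcR -hnormE.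
by near: y; apply: cvgr_dist_lt.
Unshelve. all: by end_near. Qed.

Lemma bounded_linear V W (T : V -> W) : bounded_op T -> linear T.
Proof. by case. Qed.

Lemma bounded_cvg V W (T : V -> W) (u : nat -> V) x : bounded_op T ->
  u @ \oo --> x -> (fun n => T (u n)) @ \oo --> T x.
Proof. by move=> [_ Tc] ux; apply: continuous_cvg => //; exact: Tc. Qed.

Lemma bounded_id V : bounded_op (@id V).
Proof. by apply/bounded_opP; split=> //; exists 1 => // v; rewrite mul1r. Qed.

Lemma bounded0 V W : bounded_op (0 : V -> W).
Proof.
apply/bounded_opP; split=> [a x y|].
  by change (0 = a *: (0 : W) + 0); rewrite scaler0 addr0.
by exists 1 => // v; rewrite [X in hnorm X](_ : _ = 0)// hnorm0 mul1r hnorm_ge0.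
Qed.

Lemma bounded_comp U V W (S : V -> W) (T : U -> V) :
  bounded_op S -> bounded_op T -> bounded_op (S \o T).
Proof.
move=> /bounded_opP[Sl [c c0 Sc]] /bounded_opP[Tl [d d0 Td]].
apply/bounded_opP; split=> [a x y /=|]; first by rewrite Tl Sl.
exists (c * d); first exact: mulr_gt0.
move=> v /=; apply: le_trans (Sc _) _; rewrite -mulrA ler_wpM2l// ltW//.
Qed.

Lemma boundedD V W (S T : V -> W) :
  bounded_op S -> bounded_op T -> bounded_op (S + T).
Proof.
move=> /bounded_opP[Sl [c c0 Sc]] /bounded_opP[Tl [d d0 Td]].
apply/bounded_opP; split=> [a x y|].
  by rewrite !fctE Sl Tl scalerDr addrACA.
exists (c + d); first exact: addr_gt0.
move=> v; rewrite fctE mulrDl; apply: le_trans (ler_hnormD _ _) _.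
exact: lerD.
Qed.

Lemma boundedZ V W a (T : V -> W) : bounded_op T -> bounded_op (a *: T).
Proof.
move=> /bounded_opP[Tl [d d0 Td]]; apply/bounded_opP; split=> [b x y|].
  by rewrite !fctE Tl scalerDr !scalerA mulrC.
exists ((cabs a + 1) * d); first by rewrite mulr_gt0// ltr_pwDr// cabs_ge0.
move=> v; rewrite fctE hnormZ -mulrA ler_pM ?cabs_ge0 ?hnorm_ge0//.
by rewrite lerDl.
Qed.

Lemma boundedN V W (T : V -> W) : bounded_op T -> bounded_op (- T).
Proof. by move=> /(boundedZ (-1)); rewrite scaleN1r. Qed.

Lemma boundedB V W (S T : V -> W) :
  bounded_op S -> bounded_op T -> bounded_op (S - T).
Proof. by move=> Sb /boundedN; exact: boundedD. Qed.

(** Let [w] be the part of some [z] with [f z != 0] that is orthogonal to the kernel. Each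
    [x - (f x / f w) *: w] lies in the kernel, hence is orthogonal to [w], and this determines
    [f x]. *)
Lemma riesz V (f : V -> R[i]) c : scalar f ->
  (forall x, cabs (f x) <= c * hnorm x) -> exists y, forall x, f x = dot x y.
Proof.
move=> fl fc.
have f0 : f 0 = 0 by have := fl (-1) 0 0; rewrite scaler0 addr0 mulN1r addNr.
have fD x y : f (x + y) = f x + f y by have := fl 1 x y; rewrite scale1r mul1r.
have fZ a x : f (a *: x) = a * f x by have := fl a x 0; rewrite f0 !addr0.
have fB x y : f (x - y) = f x - f y by rewrite fD -scaleN1r fZ mulN1r.
have [[z fz]|fz] := pselect (exists z, f z != 0); last first.
  exists 0 => x; rewrite dot0r; apply/eqP/negP => /negP fx.
  by apply: fz; exists x.
have Ksub : subspace [set x | f x = 0].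
  by split=> // a x y /= fx fy; rewrite fl fx fy mulr0 addr0.
have [p [u [fu up po]]] := projection_exists z Ksub.
have fp : f p = 0.
  have cabs_eq0 a : cabs a = 0 -> a = 0.
    by move=> a0; apply/normr0_eq0; rewrite cabsE a0.
  apply: cabs_eq0; apply/eqP; rewrite eq_le cabs_ge0 andbT.
  apply/ler_addgt0Pl => e e0; rewrite addr0.
  have c1 : 0 < `|c| + 1 by rewrite ltr_pwDr.
  have [|N HN] := (hcvgP _ _).1 up (e / (`|c| + 1)); first exact: divr_gt0.
  have := HN N (leqnn _); rewrite ltr_pdivlMr// => /ltW; apply: le_trans.
  have -> : cabs (f p) = cabs (f (u N - p)).
    by rewrite fB [f (u N)]fu sub0r /cabs normrN.
  apply: le_trans (fc _) _; rewrite mulrC ler_wpM2l ?hnorm_ge0//.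
  by rewrite (le_trans (ler_norm _))// lerDl.
pose w := z - p.
have fw : f w != 0 by rewrite fB fp subr0.
have ww : dot w w != 0.
  by apply: contra_neq fw => /dot_eq0 ->; rewrite f0.
exists ((f w / dot w w)^* *: w) => x; rewrite dotZr conjCK.
have : dot (x - (f x / f w) *: w) w = 0.
  by rewrite dotC (po _ _) ?rmorph0//= fB fZ divfK ?subrr.
rewrite dotBl dotZl => /subr0_eq ->.
by rewrite mulrCA divfK// divfK.
Qed.

Lemma adj_eq V W (T : V -> W) S :
  (forall v w, dot (T v) w = dot v (S w)) -> adj T = S.
Proof.
move=> TS; apply: xget_unique => // S' TS'.
apply/funext => w; apply: dot_inj => z.
by rewrite dotC [RHS]dotC -TS -TS'.
Qed.

Lemma adjP V W (T : V -> W) : bounded_op T ->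
  forall v w, dot (T v) w = dot v (adj T w).
Proof.
move=> /bounded_opP[Tl [c c0 Tc]].
have ex w : exists y, forall v, dot (T v) w = dot v y.
  apply: (@riesz _ _ (c * hnorm w)) => [a x y|x].
    by rewrite Tl dotDl dotZl.
  apply: le_trans (cauchy_schwarz _ _) _.
  by rewrite mulrAC ler_wpM2r ?hnorm_ge0.
have [S SP] := choice ex.
by move=> v w; rewrite (@adj_eq _ _ T S).
Qed.

Lemma adjP' V W (T : V -> W) : bounded_op T ->
  forall v w, dot (adj T w) v = dot w (T v).
Proof. by move=> Tb v w; rewrite dotC -adjP// -dotC. Qed.

Lemma bounded_adj V W (T : V -> W) : bounded_op T -> bounded_op (adj T).
Proof.
move=> Tb; have /bounded_opP[Tl [c c0 Tc]] := Tb.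
apply/bounded_opP; split=> [a x y|].
  apply: dot_inj => z.
  by rewrite dotDl dotZl !adjP'// dotDl dotZl.
exists c => // w; have [|n0] := eqVneq (hnorm (adj T w)) 0.
  by move=> ->; rewrite mulr_ge0 ?hnorm_ge0 ?ltW.
have n1 : 0 < hnorm (adj T w) by rewrite lt_neqAle eq_sym n0 hnorm_ge0.
rewrite -(ler_pM2r n1) -expr2 -Re_dot adjP'//.
apply: le_trans (Re_le_cabs _) _; apply: le_trans (cauchy_schwarz _ _) _.
rewrite mulrC mulrAC ler_wpM2r ?hnorm_ge0//.
Qed.

End BoundedOperators.

(** * The ring of bounded operators *)

Section OperatorRing.
Context {R : realType} (V : hilbertType R).

(** Bundling boundedness makes the operators a ring, so that identities between products and
    adjoints are obtained by rewriting instead of pointwise. *)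
Record bop := Bop { bop_fun :> V -> V; bop_bounded : bounded_op bop_fun }.

Lemma bop_ext (a b : bop) : (forall x, a x = b x) -> a = b.
Proof.
case: a b => [f fb] [g gb] /= /funext fg; case: g / fg gb => gb.
by rewrite (Prop_irrelevance fb gb).
Qed.

HB.instance Definition _ := gen_eqMixin bop.
HB.instance Definition _ := gen_choiceMixin bop.

Definition bop_add a b := Bop (boundedD (bop_bounded a) (bop_bounded b)).
Definition bop_opp a := Bop (boundedN (bop_bounded a)).
Definition bop_mul a b := Bop (bounded_comp (bop_bounded a) (bop_bounded b)).

Fact bop_addA : associative bop_add.
Proof. by move=> a b c; apply: bop_ext => x; exact: addrA. Qed.
Fact bop_addC : commutative bop_add.
Proof. by move=> a b; apply: bop_ext => x; exact: addrC. Qed.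
Fact bop_add0 : left_id (Bop (bounded0 V V)) bop_add.
Proof. by move=> a; apply: bop_ext => x; exact: add0r. Qed.
Fact bop_addN : left_inverse (Bop (bounded0 V V)) bop_opp bop_add.
Proof. by move=> a; apply: bop_ext => x; exact: addNr. Qed.

HB.instance Definition _ :=
  GRing.isZmodule.Build bop bop_addA bop_addC bop_add0 bop_addN.

Fact bop_mulA : associative bop_mul.
Proof. by move=> a b c; apply: bop_ext. Qed.
Fact bop_mul1 : left_id (Bop (bounded_id V)) bop_mul.
Proof. by move=> a; apply: bop_ext. Qed.
Fact bop_mulr1 : right_id (Bop (bounded_id V)) bop_mul.
Proof. by move=> a; apply: bop_ext. Qed.
Fact bop_mulDl : left_distributive bop_mul bop_add.
Proof. by move=> a b c; apply: bop_ext. Qed.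
Fact bop_mulDr : right_distributive bop_mul bop_add.
Proof.
move=> a b c; apply: bop_ext => x.
exact: linear_opD (bounded_linear (bop_bounded a)).
Qed.

HB.instance Definition _ := GRing.Zmodule_isPzRing.Build bop
  bop_mulA bop_mul1 bop_mulr1 bop_mulDl bop_mulDr.

Implicit Types (a b c : bop) (x y : V).

Lemma bopD a b x : (a + b) x = a x + b x. Proof. by []. Qed.
Lemma bopN a x : (- a) x = - a x. Proof. by []. Qed.
Lemma bopB a b x : (a - b) x = a x - b x. Proof. by []. Qed.
Lemma bopM a b x : (a * b) x = a (b x). Proof. by []. Qed.
Lemma bop1 x : (1 : bop) x = x. Proof. by []. Qed.
Lemma bop0 x : (0 : bop) x = 0. Proof. by []. Qed.

Lemma bop_linear a : linear a.
Proof. exact: bounded_linear (bop_bounded a). Qed.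
Lemma bop_x0 a : a 0 = 0.
Proof. exact: linear_op0 (bop_linear a). Qed.
Lemma bop_xD a x y : a (x + y) = a x + a y.
Proof. exact: linear_opD (bop_linear a). Qed.
Lemma bop_xB a x y : a (x - y) = a x - a y.
Proof. exact: linear_opB (bop_linear a). Qed.
Lemma bop_xZ a k x : a (k *: x) = k *: a x.
Proof. exact: linear_opZ (bop_linear a). Qed.

Definition star a := Bop (bounded_adj (bop_bounded a)).

Lemma dot_star a x y : dot (a x) y = dot x (star a y).
Proof. exact: adjP (bop_bounded a) x y. Qed.

Lemma star_eq a b : (forall x y, dot (a x) y = dot x (b y)) -> star a = b.
Proof. by move=> /adj_eq ab; apply: bop_ext => x /=; rewrite ab. Qed.

Lemma starK : involutive star.
Proof. by move=> a; apply: star_eq => x y; rewrite dotC -dot_star -dotC. Qed.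

Lemma star_dot a x y : dot (star a x) y = dot x (a y).
Proof. by rewrite dot_star starK. Qed.

Lemma starM a b : star (a * b) = star b * star a.
Proof. by apply: star_eq => x y; rewrite !bopM !dot_star. Qed.

Lemma starD a b : star (a + b) = star a + star b.
Proof. by apply: star_eq => x y; rewrite !bopD dotDl dotDr !dot_star. Qed.

Lemma starN a : star (- a) = - star a.
Proof. by apply: star_eq => x y; rewrite !bopN dotNl dotNr !dot_star. Qed.

Lemma starB a b : star (a - b) = star a - star b.
Proof. by rewrite starD starN. Qed.

Lemma star1 : star 1 = 1.
Proof. exact: star_eq. Qed.

Lemma star0 : star 0 = 0.
Proof. by apply: star_eq => x y; rewrite dot0l dot0r. Qed.

Lemma starX a n : star (a ^+ n) = star a ^+ n.
Proof. by elim: n => [|n IH]; rewrite ?star1// exprS starM IH exprSr. Qed.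

(** With [b] the modulus of [a], this is what makes the pairs [(b z, a z)] an isometric relation. *)
Lemma hnorm_star_mul a b x : star a * a = star b * b ->
  hnorm (a x) = hnorm (b x).
Proof.
move=> ab; apply/eqP; rewrite -(eqrXn2 (ltn0Sn 1)) ?hnorm_ge0// -!Re_dot.
by rewrite !dot_star -!bopM ab.
Qed.

Definition projector a : Prop := a * a = a /\ star a = a.

Definition contraction a : Prop := forall x, hnorm (a x) <= hnorm x.

Definition bscale (k : R[i]) : bop := Bop (boundedZ k (bounded_id V)).

Lemma bscaleE k x : bscale k x = k *: x. Proof. by []. Qed.

Lemma bscale_comm k a : bscale k * a = a * bscale k.
Proof. by apply: bop_ext => x; rewrite !bopM !bscaleE bop_xZ. Qed.

Lemma bscaleM k l : bscale k * bscale l = bscale (k * l).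
Proof. by apply: bop_ext => x; rewrite bopM !bscaleE scalerA. Qed.

Lemma star_bscale k : star (bscale k) = bscale (k^*).
Proof. by apply: star_eq => x y; rewrite !bscaleE dotZl dotZr conjCK. Qed.

Lemma star_bscale_real (k : R) : star (bscale k%:C) = bscale k%:C.
Proof. by rewrite star_bscale; congr bscale; exact: conjc_real. Qed.

Lemma bscale1 : bscale 1 = 1.
Proof. by apply: bop_ext => x; rewrite bscaleE scale1r. Qed.

End OperatorRing.

(** * Square roots and moduli *)

Section SquareRoot.
Context {R : realType} {V : hilbertType R}.
Variable X : bop V.

(* The iteration Y <- (X + Y^2) / 2 converges to 1 - sqrt (1 - X). *)
Fixpoint sqrt_approx n : bop V :=
  if n is m.+1 then bscale V 2^-1 * (X + sqrt_approx m * sqrt_approx m) else 0.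

(** The scalar case [X = 1]. It dominates the operator iteration in norm, and its increments
    dominate the operator increments. *)
Fixpoint sqrt_approx1 n : R :=
  if n is m.+1 then 2^-1 * (1 + sqrt_approx1 m * sqrt_approx1 m) else 0.

Local Notation Y := sqrt_approx.
Local Notation y := sqrt_approx1.

Lemma sqrt_approxS n x : Y n.+1 x = (2^-1 : R[i]) *: (X x + Y n (Y n x)).
Proof. by []. Qed.

Lemma sqrt_approx1_itv n : 0 <= y n <= 1.
Proof.
elim: n => [|n /andP[IH0 IH1]] /=; first by rewrite lexx ler01.
have H : y n * y n <= 1 by rewrite mulr_ile1.
have H0 : 0 <= y n * y n by rewrite mulr_ge0.
by apply/andP; split; lra.
Qed.

Lemma sqrt_approx1_incr n : y n <= y n.+1.
Proof.
elim: n => [|n IH] /=; first by rewrite mul0r addr0 mulr1; lra.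
have /andP[h0 h1] := sqrt_approx1_itv n.
have : y n * y n <= y n.+1 * y n.+1 by apply: ler_pM.
by move=> /=; lra.
Qed.

Lemma sqrt_approx_comm n (S : bop V) : S * X = X * S -> S * Y n = Y n * S.
Proof.
move=> SX; elim: n => [|n IH] /=; first by rewrite mulr0 mul0r.
rewrite mulrA -bscale_comm -!mulrA; congr (_ * _).
by rewrite mulrDr mulrDl SX mulrA IH -!mulrA IH.
Qed.

Hypothesis Xstar : star X = X.
Hypothesis Xcontr : contraction X.

Lemma hnorm_half x : hnorm ((2^-1 : R[i]) *: x : V) = 2^-1 * hnorm x.
Proof.
rewrite hnormZ; congr (_ * _).
have -> : (2^-1 : R[i]) = (2^-1 : R)%:C by rewrite fmorphV rmorph_nat.
by rewrite cabs_real ger0_norm.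
Qed.

Lemma sqrt_approx_le n x : hnorm (Y n x) <= y n * hnorm x.
Proof.
elim: n x => [|n IH] x; first by rewrite /= hnorm0 mul0r.
rewrite sqrt_approxS hnorm_half [y _]/= -mulrA ler_wpM2l// mulrDl mul1r.
apply: le_trans (ler_hnormD _ _) _; apply: lerD => //.
apply: le_trans (IH _) _; rewrite -mulrA ler_wpM2l//.
by have /andP[] := sqrt_approx1_itv n.
Qed.

(** The identity [a^2 - b^2 = a (a - b) + (a - b) b] holds without commutativity, and its scalar
    counterpart has nonnegative factors, so the bound propagates by induction. *)
Lemma sqrt_approx_step n x :
  hnorm (Y n.+1 x - Y n x) <= (y n.+1 - y n) * hnorm x.
Proof.
elim: n x => [|n IH] x.
  rewrite sqrt_approxS !bop0 addr0 subr0 hnorm_half /= mul0r addr0 subr0 mulr1.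
  by rewrite ler_wpM2l.
have -> : Y n.+2 x - Y n.+1 x = (2^-1 : R[i]) *:
    (Y n.+1 (Y n.+1 x - Y n x) + (Y n.+1 (Y n x) - Y n (Y n x))).
  rewrite (sqrt_approxS n.+1 x) [X in _ - X = _]sqrt_approxS -scalerBr.
  by rewrite bop_xB addrA subrK opprD addrACA subrr add0r.
rewrite hnorm_half.
have -> : y n.+2 - y n.+1 =
    2^-1 * (y n.+1 * (y n.+1 - y n) + (y n.+1 - y n) * y n).
  have E k : y k.+1 = 2^-1 * (1 + y k * y k) by [].
  by rewrite (E n.+1) [X in _ - X = _](E n); ring.
rewrite -mulrA ler_wpM2l//.
apply: le_trans (ler_hnormD _ _) _; rewrite mulrDl; apply: lerD.
  apply: le_trans (sqrt_approx_le _ _) _; rewrite -mulrA ler_wpM2l//.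
  by have /andP[] := sqrt_approx1_itv n.+1.
apply: le_trans (IH _) _; rewrite -mulrA ler_wpM2l ?sqrt_approx_le//.
by rewrite subr_ge0 sqrt_approx1_incr.
Qed.

Lemma sqrt_approx_dist m n x : (n <= m)%N ->
  hnorm (Y m x - Y n x) <= (y m - y n) * hnorm x.
Proof.
elim: m => [|m IH]; first by rewrite leqn0 => /eqP ->;
  rewrite !subrr hnorm0 mul0r.
rewrite leq_eqVlt => /orP[/eqP->|]; first by rewrite !subrr hnorm0 mul0r.
move=> /IH H; rewrite -(subrK (Y m x) (Y m.+1 x)) -addrA.
apply: le_trans (ler_hnormD _ _) _.
have -> : (y m.+1 - y n) * hnorm x =
   (y m.+1 - y m) * hnorm x + (y m - y n) * hnorm x by ring.
by apply: lerD => //; exact: sqrt_approx_step.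
Qed.

Lemma sqrt_approx_cvg x : exists z : V, (fun n => Y n x) @ \oo --> z.
Proof.
have yc : cvg (y @ \oo).
  apply: nondecreasing_is_cvgn; first by apply/nondecreasing_seqP;
    exact: sqrt_approx1_incr.
  by exists 1 => _ [n _ <-]; have /andP[] := sqrt_approx1_itv n.
apply: hcauchy_cvg => e e0.
have x1 : 0 < hnorm x + 1 by rewrite ltr_wpDl// hnorm_ge0.
have e1 : 0 < e / (hnorm x + 1) / 2 by rewrite !divr_gt0.
have /cvgrPdist_lt /(_ _ e1) [N _ HN] := yc.
have H m n : (N <= m)%N -> (n <= m)%N -> (N <= n)%N ->
  hnorm (Y m x - Y n x) < e.
  move=> Nm nm Nn; apply: le_lt_trans (sqrt_approx_dist _ nm) _.
  have := HN _ Nm; have := HN _ Nn;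
    rewrite /= !ltr_norml => /andP[A B] /andP[C D].
  have F : (y m - y n) * hnorm x <= (y m - y n) * (hnorm x + 1).
    rewrite ler_wpM2l ?lerDl// subr_ge0.
    by have /nondecreasing_seqP := sqrt_approx1_incr; apply.
  apply: le_lt_trans F _; rewrite -ltr_pdivlMr//; lra.
exists N => m n Nm Nn; have [nm|/ltnW mn] := leqP n m; first exact: H.
by rewrite hdistC; exact: H.
Qed.

(** The limit [z] satisfies [z + z = X + z * z], that is [(1 - z)^2 = 1 - X]. Self-adjointness and
    commutation pass from the iterates to the limit. *)
Lemma sqrt_exists : exists Q : bop V,
  [/\ star Q = Q, Q * Q = 1 - X
    & forall S : bop V, S * X = X * S -> S * Q = Q * S].
Proof.
have [Z ZP] := choice sqrt_approx_cvg.
have Zle x : hnorm (Z x) <= hnorm x.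
  apply: (ler_cvg_to (hcvg_norm (ZP x)) (cvg_cst (hnorm x))).
  apply: nearW => n; apply: le_trans (sqrt_approx_le _ _) _.
  by rewrite ler_piMl ?hnorm_ge0//; have /andP[] := sqrt_approx1_itv n.
have Zb : bounded_op Z.
  apply/bounded_opP; split=> [a u v|]; last first.
    by exists 1 => // v; rewrite mul1r.
  apply: (hcvg_unique (ZP _)).
  under eq_fun do rewrite bop_linear.
  by apply: hcvgD => //; exact: hcvgZ.
pose z := Bop Zb.
have zP x : (fun n => Y n x) @ \oo --> z x := ZP x.
(* Convergence is only pointwise; squares converge as well because the [Y n] are contractions. *)
have zz x : (fun n => Y n (Y n x)) @ \oo --> z (z x).
  apply/hcvgP => e e0; have e2 : 0 < e / 2 by rewrite divr_gt0.
  have [N1 H1] := (hcvgP _ _).1 (zP x) _ e2.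
  have [N2 H2] := (hcvgP _ _).1 (zP (z x)) _ e2.
  exists (maxn N1 N2) => n; rewrite geq_max => /andP[/H1 A /H2 B].
  have -> : Y n (Y n x) - z (z x) = Y n (Y n x - z x) + (Y n (z x) - z (z x)).
    by rewrite bop_xB addrA subrK.
  apply: le_lt_trans (ler_hnormD _ _) _.
  have C : hnorm (Y n (Y n x - z x)) <= hnorm (Y n x - z x).
    apply: le_trans (sqrt_approx_le _ _) _.
    by rewrite ler_piMl ?hnorm_ge0//; have /andP[] := sqrt_approx1_itv n.
  by lra.
have zE : z = bscale V 2^-1 * (X + z * z).
  apply: bop_ext => x.
  have H : (fun n => Y n.+1 x) @ \oo --> z x.
    by have := zP x; rewrite -(cvg_shiftS (fun n => Y n x)).
  apply: (hcvg_unique H).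
  rewrite bopM bscaleE bopD bopM; under eq_fun do rewrite sqrt_approxS.
  by apply: hcvgZ; apply: hcvgD; [exact: hcvg_cst|exact: zz].
have two : z + z = X + z * z.
  have h : bscale V 2^-1 + bscale V 2^-1 = 1.
    apply: bop_ext => x; rewrite bopD !bscaleE -scalerDl bop1.
    by rewrite -[RHS]scale1r; congr (_ *: _); field.
  by rewrite [in LHS]zE -mulrDl h mul1r.
exists (1 - z); split.
- rewrite starB star1; congr (_ - _); apply: star_eq => u v.
  have Ystar n : star (Y n) = Y n.
    elim: n => [|n IH] /=; first exact: star0.
    have -> : (2^-1 : R[i]) = (2^-1 : R)%:C by rewrite fmorphV rmorph_nat.
    by rewrite starM starD starM IH Xstar star_bscale_real bscale_comm.
  apply: (hcvg_dot_eq (zP u) (@hcvg_cst _ _ v) (@hcvg_cst _ _ u) (zP v)) => n.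
  by rewrite dot_star Ystar.
- have zzE : z * z = z + z - X by rewrite two addrAC subrr add0r.
  rewrite mulrBl mul1r mulrBr mulr1 opprB zzE [z + z - X - z]addrAC addrK.
  by rewrite addrA subrK.
- move=> S SX; rewrite mulrBr mulrBl mulr1 mul1r; congr (_ - _).
  apply: bop_ext => x; rewrite !bopM.
  apply: (hcvg_unique (bounded_cvg (bop_bounded S) (zP x))).
  under eq_fun do rewrite -bopM sqrt_approx_comm// bopM.
  exact: zP.
Qed.

End SquareRoot.

Section Modulus.
Context {R : realType}.
Implicit Types V W : hilbertType R.

(* [Q] is a self-adjoint square root of [adj T \o T]; positivity is not needed. *)
Lemma modulus_exists V W (T : V -> W) : bounded_op T -> exists Q : bop V,
  [/\ star Q = Q, forall x, Q (Q x) = adj T (T x)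
    & forall S : bop V, (forall x, S (adj T (T x)) = adj T (T (S x))) ->
        S * Q = Q * S].
Proof.
move=> Tb; have /bounded_opP[Tl [c c0 Tc]] := Tb.
pose t := Bop (bounded_comp (bounded_adj Tb) Tb).
have dott x y : dot (t x) y = dot (T x) (T y) by exact: adjP'.
have tstar : star t = t.
  by apply: star_eq => x y; rewrite dott dotC -dott -dotC.
(* Since [t <= c ^+ 2], the operator [1 - k t] is a contraction; the root of [k t] is rescaled by
   [c] at the end. *)
pose k : R := (c ^+ 2)^-1.
have k0 : 0 < k by rewrite invr_gt0 exprn_gt0.
pose X : bop V := 1 - bscale V k%:C * t.
have Xstar : star X = X.
  by rewrite starB star1 starM tstar star_bscale_real -bscale_comm.
have Xcontr : contraction X.
  move=> x; rewrite -(ler_pXn2r (ltn0Sn 1)) ?nnegrE ?hnorm_ge0//.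
  rewrite bopB bop1 bopM bscaleE hnorm_sqrB hnormZ cabs_real gtr0_norm//.
  have ttx : hnorm (t x) <= c * hnorm (T x).
    have [->|n0] := eqVneq (hnorm (t x)) 0.
      by rewrite mulr_ge0 ?hnorm_ge0 ?ltW.
    have n1 : 0 < hnorm (t x) by rewrite lt_neqAle eq_sym n0 hnorm_ge0.
    rewrite -(ler_pM2r n1) -expr2 -Re_dot dott.
    apply: le_trans (Re_le_cabs _) _; apply: le_trans (cauchy_schwarz _ _) _.
    by rewrite mulrAC mulrC ler_wpM2r ?hnorm_ge0.
  have -> : dot x (k%:C *: t x) = (k * hnorm (T x) ^+ 2)%:C.
    rewrite dotZr -tstar -dot_star dott dotE realCM; congr (_ * _).
    exact: conjc_real.
  have A : (k * hnorm (t x)) ^+ 2 <= k * hnorm (T x) ^+ 2.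
    have -> : (k * hnorm (t x)) ^+ 2 = k * (k * hnorm (t x) ^+ 2) by ring.
    rewrite ler_pM2l// mulrC ler_pdivrMr ?exprn_gt0// -exprMn mulrC.
    by rewrite ler_pXn2r ?nnegrE ?mulr_ge0 ?hnorm_ge0 ?(ltW c0).
  have B : 0 <= k * hnorm (T x) ^+ 2
    by rewrite mulr_ge0 ?exprn_ge0 ?hnorm_ge0 ?ltW.
  by rewrite /=; lra.
have [Q [Qstar QQ QS]] := sqrt_exists Xstar Xcontr.
exists (bscale V c%:C * Q); split.
- by rewrite starM Qstar star_bscale_real bscale_comm.
- move=> x; rewrite -bopM.
  have -> : bscale V c%:C * Q * (bscale V c%:C * Q) = t.
    rewrite mulrA -bscale_comm !mulrA bscaleM -mulrA QQ /X subKr mulrA bscaleM.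
    have -> : c%:C * c%:C * k%:C = 1 :> R[i].
      rewrite -!realCM /k -expr2 mulfV//.
      by rewrite expf_neq0// gt_eqF.
    by rewrite bscale1 mul1r.
  by [].
- move=> S St; rewrite -mulrA -QS ?mulrA ?bscale_comm//.
  rewrite /X mulrBr mulrBl mulr1 mul1r; congr (_ - _).
  rewrite mulrA -bscale_comm -!mulrA; congr (_ * _).
  by apply: bop_ext => x; exact: St.
Qed.

End Modulus.

(** * Partial isometries and maximal extensions *)

Section IsometricGraphs.
Context {R : realType} {V : hilbertType R}.
Implicit Types (G : set (V * V)) (x y z : V).

(** A relation avoids naming its domain, which need not be closed. Single-valuedness follows from
    [graph_norm] applied to a difference of two pairs. *)
Record isometric_graph G : Prop := {
  graph0 : G (0, 0);
  graphP : forall (a : R[i]) x y x' y', G (x, y) -> G (x', y') ->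
    G (a *: x + x', a *: y + y');
  graph_norm : forall x y, G (x, y) -> hnorm x = hnorm y
}.

Lemma graph_dot G x y x' y' : isometric_graph G ->
  G (x, y) -> G (x', y') -> dot x x' = dot y y'.
Proof.
move=> Gi Gxy Gxy'.
have H a : complex.Re (a * dot x x') = complex.Re (a * dot y y').
  have := graph_norm Gi (graphP Gi a Gxy Gxy').
  move/(congr1 (fun r => r ^+ 2)); rewrite !hnorm_sqrD !hnormZ.
  by rewrite (graph_norm Gi Gxy) (graph_norm Gi Gxy') !dotZl; lra.
(* Polarization: the factor [1] compares real parts, the factor [- 'i] imaginary parts. *)
have := H 1; have := H (- 'i%C).
case: (dot x x') (dot y y') => [a b] [c d] /=.
by move=> h1 h2; congr (_ +i* _); lra.
Qed.

Lemma graph_inv G : isometric_graph G -> isometric_graph [set p | G (p.2, p.1)].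
Proof.
move=> Gi; split=> [|a x y x' y' /=|x y /= /(graph_norm Gi)//].
  exact: graph0 Gi.
exact: graphP Gi _ _ _ _ _.
Qed.

(** [p.1] is the projection of [z] onto the closed domain, and [p.2] its image under the extension
    by continuity: the isometry makes [v] Cauchy along with [u]. *)
Lemma graph_lim G z : isometric_graph G ->
  exists p : V * V, exists u v : nat -> V,
  [/\ forall n, G (u n, v n), u @ \oo --> p.1, v @ \oo --> p.2
    & forall a b, G (a, b) -> dot (z - p.1) a = 0].
Proof.
move=> Gi.
have Dsub : subspace [set x | exists y, G (x, y)].
  split=> [|a x x' /= [y xy] [y' xy']]; first by exists 0; exact: graph0 Gi.
  by exists (a *: y + y'); exact: graphP Gi _ _ _ _ _ xy xy'.
have [x [u [/choice[v Guv] ux xo]]] := projection_exists z Dsub.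
have [y vy] : exists y, v @ \oo --> y.
  apply: hcauchy_cvg => e e0.
  have /hcvgP/(_ (e / 2)) [|N HN] := ux; first by rewrite divr_gt0.
  exists N => m n /HN A /HN B.
  have -> : hnorm (v m - v n) = hnorm (u m - u n).
    have := graphP Gi (-1) (Guv n) (Guv m); rewrite !scaleN1r ![- _ + _]addrC.
    by move/(graph_norm Gi).
  have -> : u m - u n = (u m - x) + - (u n - x) by rewrite opprB addrA subrK.
  apply: le_lt_trans (ler_hnormD _ _) _; rewrite hnorm_opp; lra.
by exists (x, y), u, v; split=> // a b Gab; apply: xo; exists b.
Qed.

(** [W] is zero on the complement of the domain, and the inverse relation provides its adjoint. The
    third clause approximates [star W (W z)] and [W z] by pairs of [G], so that later identities for
    [W] need checking on [G] alone. *)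
Lemma partial_isometry_of_graph G : isometric_graph G -> exists W : bop V,
  [/\ forall x y, G (x, y) -> W x = y,
      forall x y, G (x, y) -> star W y = x,
      forall z, exists u v : nat -> V, [/\ forall n, G (u n, v n),
        u @ \oo --> star W (W z) & v @ \oo --> W z]
    & forall S : bop V, (forall x y, G (x, y) -> G (S x, S y)) ->
        (forall x y, G (x, y) -> G (star S x, star S y)) -> S * W = W * S].
Proof.
move=> Gi.
have [F FP] := choice (fun z => graph_lim z Gi).
have [F' FP'] := choice (fun z => graph_lim z (graph_inv Gi)).
(* In each product the free vector may be replaced by its projection, onto the closed range for [w]
   and onto the closed domain for [z]. Linearity of the chosen [F] follows from this formula. *)
have adjW z w : dot (F z).2 w = dot z (F' w).2.
  have [u [v [Guv up vp o]]] := FP z.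
  have [u' [v' [/= Guv' up' vp' o']]] := FP' w.
  have -> : dot (F z).2 w = dot (F z).2 (F' w).1.
    apply/esym/subr0_eq; rewrite -dotBr dotC -opprB dotNl.
    suff -> : dot (w - (F' w).1) (F z).2 = 0 by rewrite oppr0 rmorph0.
    rewrite -(dot0l (0 : V)).
    apply: (hcvg_dot_eq (@hcvg_cst _ _ _) vp (@hcvg_cst _ _ _)
      (@hcvg_cst _ _ _)).
    by move=> n; rewrite dot0l; exact: o' (Guv n).
  have -> : dot (F z).2 (F' w).1 = dot (F z).1 (F' w).2.
    apply: (hcvg_dot_eq vp up' up vp') => n.
    by apply/esym; exact: graph_dot (Guv n) (Guv' n).
  apply/esym/subr0_eq; rewrite -dotBl -(dot0l (0 : V)).
  apply: (hcvg_dot_eq (@hcvg_cst _ _ _) vp' (@hcvg_cst _ _ _)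
    (@hcvg_cst _ _ _)).
  by move=> n; rewrite dot0l; exact: o (Guv' n).
have Wiso z z' : dot (F z).2 (F z').2 = dot (F z).1 z'.
  have [u [v [Guv up vp o]]] := FP z.
  have [u' [v' [/= Guv' up' vp' o']]] := FP z'.
  have -> : dot (F z).2 (F z').2 = dot (F z).1 (F z').1.
    apply: (hcvg_dot_eq vp vp' up up') => n.
    by apply/esym; exact: graph_dot (Guv n) (Guv' n).
  apply/esym/subr0_eq; rewrite -dotBr dotC.
  suff -> : dot (z' - (F z').1) (F z).1 = 0 by rewrite rmorph0.
  rewrite -(dot0l (0 : V)).
  apply: (hcvg_dot_eq (@hcvg_cst _ _ _) up (@hcvg_cst _ _ _) (@hcvg_cst _ _ _)).
  by move=> n; rewrite dot0l; exact: o' (Guv n).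
have Wb : bounded_op (fun z => (F z).2).
  apply/bounded_opP; split=> [a x y|].
    by apply: dot_inj => w; rewrite dotDl dotZl !adjW dotDl dotZl.
  exists 1 => // z; rewrite mul1r.
  have [//|n0] := eqVneq (hnorm (F z).2) 0.
    by move=> ->; exact: hnorm_ge0.
  have [u [v [Guv up vp o]]] := FP z.
  have nE : hnorm (F z).2 = hnorm (F z).1.
    apply: cvg_unique (hcvg_norm vp) _ => //.
    have -> : (fun n => hnorm (v n)) = (fun n => hnorm (u n)).
      by apply/funext => n; rewrite (graph_norm Gi (Guv n)).
    exact: hcvg_norm.
  have n1 : 0 < hnorm (F z).2 by rewrite lt_neqAle eq_sym n0 hnorm_ge0.
  rewrite -(ler_pM2l n1) -expr2 -Re_dot Wiso {1}nE.
  by apply: le_trans (Re_le_cabs _) _; exact: cauchy_schwarz.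
pose W := Bop Wb.
have WE z w : dot (W z) w = dot z (F' w).2 := adjW z w.
have W'E w : star W w = (F' w).2.
  apply: dot_inj => z; rewrite dotC -dot_star WE -dotC//.
have PE z : star W (W z) = (F z).1.
  by apply: dot_inj => w; rewrite star_dot; exact: Wiso.
exists W; split.
- move=> x y Gxy; apply: dot_inj => w; rewrite WE.
  have [u' [v' [/= Guv' up' vp' o']]] := FP' w.
  have -> : dot x (F' w).2 = dot y (F' w).1.
    apply: (hcvg_dot_eq (@hcvg_cst _ _ _) vp' (@hcvg_cst _ _ _) up') => n.
    exact: graph_dot Gxy (Guv' n).
  by apply/subr0_eq; rewrite -dotBr dotC -opprB dotNl (o' _ _ Gxy) oppr0
    rmorph0.
- move=> x y Gxy; apply: dot_inj => z.
  have [u [v [Guv up vp o]]] := FP z.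
  rewrite star_dot.
  have -> : dot y (W z) = dot x (F z).1.
    apply: (hcvg_dot_eq (@hcvg_cst _ _ _) vp (@hcvg_cst _ _ _) up) => n.
    by apply/esym; exact: graph_dot Gxy (Guv n).
  by apply/subr0_eq; rewrite -dotBr dotC -opprB dotNl (o _ _ Gxy) oppr0 rmorph0.
- move=> z; have [u [v [Guv up vp o]]] := FP z.
  by exists u, v; rewrite PE.
- move=> S SG SG'; apply: bop_ext => z; rewrite !bopM.
  have [u [v [Guv up vp o]]] := FP z.
  have Wuv a b : G (a, b) -> W a = b.
    move=> Gab; apply: dot_inj => w; rewrite WE.
    have [u' [v' [/= Guv' up' vp' o']]] := FP' w.
    have -> : dot a (F' w).2 = dot b (F' w).1.
      apply: (hcvg_dot_eq (@hcvg_cst _ _ _) vp' (@hcvg_cst _ _ _) up') => n.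
      exact: graph_dot Gab (Guv' n).
    by apply/subr0_eq; rewrite -dotBr dotC -opprB dotNl (o' _ _ Gab) oppr0
      rmorph0.
  have H1 : W (S (F z).1) = S (W z).
    have Sv := bounded_cvg (bop_bounded S) vp.
    have Su := bounded_cvg (bop_bounded (W * S)) up.
    apply: hcvg_unique Su _.
    under eq_fun => n do rewrite bopM (Wuv _ _ (SG _ _ (Guv n))).
    exact: Sv.
  (* It remains that [S] preserves the complement of the domain, where [W] is zero; this holds
     because [star S] preserves the domain. *)
  rewrite -H1; apply/esym/subr0_eq; rewrite -!bop_xB.
  apply: dot_inj => w; rewrite WE dot0l dot_star.
  have [u' [v' [/= Guv' up' vp' o']]] := FP' w.
  rewrite -(dot0l (0 : V)) -dot_star.
  apply: (hcvg_dot_eq (@hcvg_cst _ _ _) vp' (@hcvg_cst _ _ _)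
    (@hcvg_cst _ _ _)).
  by move=> n; rewrite dot0l dot_star; exact: o (SG' _ _ (Guv' n)).
Qed.

End IsometricGraphs.

(** * Commutants of star-closed sets *)

Section Commutants.
Context {R : realType} {V : hilbertType R}.
Implicit Types (S : set (V -> V)) (a b : bop V).

(** The amplification and the relative commutant of a homomorphism are both commutants of such sets,
    so one set of closure lemmas serves both, and membership is a commutation test. *)
Definition star_closed S : Prop :=
  S `<=` bounded_op (V:=V) (W:=V) /\ forall T, S T -> S (adj T).

Lemma commutantP S a : star_closed S ->
  commutant S a <-> forall s : bop V, S s -> s * a = a * s.
Proof.
move=> [Sb _]; split=> [[_ aS] s /aS as_|aS].
  by apply/esym/bop_ext => x; exact: (congr1 (@^~ x) as_).
split=> [|s Ss]; first exact: bop_bounded.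
by have := aS (Bop (Sb _ Ss)) Ss => /(congr1 (@bop_fun _ _)) /esym.
Qed.

Lemma commutant_bounded S T : commutant S T -> bounded_op T.
Proof. by case. Qed.

Section StarClosed.
Variables (S : set (V -> V)) (Ss : star_closed S).

Lemma star_closed_star a : S a -> S (star a).
Proof. by case: Ss => _; exact. Qed.

Lemma commutant1 : commutant S (1 : bop V).
Proof. by apply/commutantP => // s _; rewrite mulr1 mul1r. Qed.

Lemma commutant0 : commutant S (0 : bop V).
Proof. by apply/commutantP => // s _; rewrite mulr0 mul0r. Qed.

Lemma commutantD a b : commutant S a -> commutant S b -> commutant S (a + b).
Proof.
move=> /(commutantP _ Ss) aS /(commutantP _ Ss) bS; apply/commutantP => // s H.
by rewrite mulrDl mulrDr aS// bS.
Qed.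

Lemma commutantN a : commutant S a -> commutant S (- a).
Proof.
move=> /(commutantP _ Ss) aS; apply/commutantP => // s H.
by rewrite mulNr mulrN aS.
Qed.

Lemma commutantB a b : commutant S a -> commutant S b -> commutant S (a - b).
Proof. by move=> aS /commutantN; exact: commutantD. Qed.

Lemma commutantM a b : commutant S a -> commutant S b -> commutant S (a * b).
Proof.
move=> /(commutantP _ Ss) aS /(commutantP _ Ss) bS; apply/commutantP => // s H.
by rewrite mulrA aS// -mulrA bS// mulrA.
Qed.

Lemma commutantX a n : commutant S a -> commutant S (a ^+ n).
Proof.
move=> aS; elim: n => [|n IH]; first exact: commutant1.
by rewrite exprS; exact: commutantM.
Qed.

Lemma commutant_scale k : commutant S (bscale V k).
Proof. by apply/commutantP => // s _; rewrite bscale_comm. Qed.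

Lemma commutant_star a : commutant S a -> commutant S (star a).
Proof.
move=> /(commutantP _ Ss) aS; apply/commutantP => // s H.
apply: (can_inj (@starK _ _)); rewrite !starM starK aS//.
exact: star_closed_star.
Qed.

End StarClosed.

Lemma commutant_star_closed S : star_closed S -> star_closed (commutant S).
Proof.
move=> Ss; split=> [T|T TS]; first exact: commutant_bounded.
exact: (@commutant_star S Ss (Bop (commutant_bounded TS))).
Qed.

Lemma commutant_modulus S (Ss : star_closed S) a : commutant S a ->
  exists Q : bop V, [/\ commutant S Q, star Q = Q & Q * Q = star a * a].
Proof.
move=> aS; have [Q [Qstar QQ QS]] := modulus_exists (bop_bounded a).
exists Q; split=> //; last by apply: bop_ext => x; exact: QQ.
apply/commutantP => // s H; apply: QS => x.
have /(commutantP _ Ss) aS' := commutantM Ss (commutant_star Ss aS) aS.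
exact: (congr1 (fun t : bop V => t x) (aS' _ H)).
Qed.

End Commutants.

(** * Maximal partial isometries between two projections *)

Section MaximalPartialIsometry.
Context {R : realType} {V : hilbertType R}.
Variables (S : set (V -> V)) (e f : bop V).
Hypotheses (Ss : star_closed S) (ep : projector e) (fp : projector f).

(** The pair [(0, 0)] is not demanded, so that the union of the empty chain qualifies in Zorn's
    lemma; maximality supplies the pair afterwards. *)
Record invariant_graph (G : set (V * V)) : Prop := {
  invariant_graphP : forall (a : R[i]) x y x' y', G (x, y) -> G (x', y') ->
    G (a *: x + x', a *: y + y');
  invariant_graph_norm : forall x y, G (x, y) -> hnorm x = hnorm y;
  invariant_graph_dom : forall x y, G (x, y) -> e x = x;
  invariant_graph_ran : forall x y, G (x, y) -> f y = y;
  invariant_graph_stable : forall (s : bop V) x y, S s -> G (x, y) ->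
    G (s x, s y)
}.

Lemma max_invariant_graph : exists G, [/\ isometric_graph G, invariant_graph G
  & forall G', invariant_graph G' -> G `<=` G' -> G' `<=` G].
Proof.
have chain (F : set (set (V * V))) : F `<=` invariant_graph ->
    total_on F subset -> invariant_graph (\bigcup_(G in F) G).
  move=> Fi Ft; split.
  - move=> a x y x' y' [G1 FG1 G1xy] [G2 FG2 G2xy].
    have [H|H] := Ft _ _ FG1 FG2.
      exists G2 => //; apply: (invariant_graphP (Fi _ FG2)) => //; exact: H.
    exists G1 => //; apply: (invariant_graphP (Fi _ FG1)) => //; exact: H.
  - by move=> x y [G FG Gxy]; exact: (invariant_graph_norm (Fi _ FG) Gxy).
  - by move=> x y [G FG Gxy]; exact: (invariant_graph_dom (Fi _ FG) Gxy).
  - by move=> x y [G FG Gxy]; exact: (invariant_graph_ran (Fi _ FG) Gxy).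
  - move=> s x y s_ [G FG Gxy]; exists G => //.
    exact: (invariant_graph_stable (Fi _ FG) s_ Gxy).
have [G [Gi Gmax]] := Zorn_bigcup chain.
have Gm G' : invariant_graph G' -> G `<=` G' -> G' `<=` G.
  by move=> G'i GG'; apply: contrapT => H; apply: (Gmax G').
exists G; split=> //; split;
  [|exact: invariant_graphP|exact: invariant_graph_norm].
pose G0 := G `|` [set (0, 0)].
suff G0i : invariant_graph G0 by apply: (Gm G0) => //; [left|right].
split.
- move=> a x y x' y' [Gxy|[-> ->]] [Gxy'|[-> ->]].
  + by left; exact: invariant_graphP.
  (* As [(0, 0)] is not yet known to be in [G], the multiple [a x] is written [(a - 1) x + x]. *)
  + left; rewrite !addr0.
    have := invariant_graphP Gi (a - 1) Gxy Gxy.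
    by rewrite !scalerBl !scale1r !subrK.
  + by left; rewrite !scaler0 !add0r.
  + by right; rewrite !scaler0 !addr0.
- by move=> x y [/(invariant_graph_norm Gi)|[-> ->]].
- by move=> x y [/(invariant_graph_dom Gi)|[-> _]]; rewrite ?bop_x0.
- by move=> x y [/(invariant_graph_ran Gi)|[_ ->]]; rewrite ?bop_x0.
- move=> s x y s_ [/(invariant_graph_stable Gi s_)|[-> ->]]; first by left.
  by right; rewrite bop_x0.
Qed.

Hypotheses (eS : commutant S e) (fS : commutant S f).

(* If [T = (f - w w^* ) x (e - w^* w)] were nonzero, the pairs [(Q z, T z)], with
   [Q] the modulus of [T], could be added to the maximal graph defining [w]. *)
Lemma max_partial_isometry : exists w : bop V,
  [/\ commutant S w, f * w = w, w * e = w, w * star w * w = w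
    & forall x : bop V, commutant S x ->
        (f - w * star w) * x * (e - star w * w) = 0].
Proof.
have [G [Gg Gi Gmax]] := max_invariant_graph.
have [w [Gw Gw' wlim wcomm]] := partial_isometry_of_graph Gg.
have [[ee est] [ff fst]] := (ep, fp).
have wS : commutant S w.
  apply/commutantP => // s Hs.
  apply: wcomm => x y; first exact: invariant_graph_stable.
  by apply: invariant_graph_stable => //; exact: star_closed_star.
have www : w * star w * w = w.
  apply: bop_ext => z; rewrite !bopM; have [u [v [Guv up vp]]] := wlim z.
  apply: (hcvg_unique (bounded_cvg (bop_bounded w) up)).
  by under eq_fun => n do rewrite (Gw _ _ (Guv n)); exact: vp.
have www' : star w * w * star w = star w.
  by rewrite -{4}www !starM starK mulrA.
have fw : f * w = w.
  apply: bop_ext => z; rewrite !bopM; have [u [v [Guv up vp]]] := wlim z.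
  apply: (hcvg_unique (bounded_cvg (bop_bounded f) vp)).
  by under eq_fun => n do rewrite (invariant_graph_ran Gi (Guv n)); exact: vp.
have we : w * e = w.
  apply: (can_inj (@starK _ _)); rewrite starM est -www'.
  apply: bop_ext => t; rewrite !bopM.
  have [u [v [Guv up vp]]] := wlim (star w t).
  apply: (hcvg_unique (bounded_cvg (bop_bounded e) up)).
  by under eq_fun => n do rewrite (invariant_graph_dom Gi (Guv n)); exact: up.
have w'f : star w * f = star w by rewrite -{2}fw starM fst.
have ew' : e * star w = star w by rewrite -{2}we starM est.
exists w; split=> // x xS; set T := _ * _ * _.
have TS : commutant S T.
  apply: commutantM => //; last first.
    by apply: commutantB => //; apply: commutantM => //; exact: commutant_star.
  apply: commutantM => //.
  by apply: commutantB => //; apply: commutantM => //; exact: commutant_star.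
have [Q [QS Qst QQ]] := commutant_modulus Ss TS.
have nQT := hnorm_star_mul _ (etrans (congr1 (fun q => q * Q) Qst) QQ).
have domT a b : G (a, b) -> T a = 0.
  move=> Gab; rewrite /T [LHS]bopM.
  have -> : (e - star w * w) a = 0.
    rewrite bopB bopM (Gw _ _ Gab) (Gw' _ _ Gab).
    by rewrite (invariant_graph_dom Gi Gab) subrr.
  exact: bop_x0.
have ranT a b : G (a, b) -> (f - w * star w) b = 0.
  move=> Gab; rewrite bopB bopM (Gw' _ _ Gab) (Gw _ _ Gab).
  by rewrite (invariant_graph_ran Gi Gab) subrr.
have Te : T * e = T.
  by rewrite /T -[LHS]mulrA [(e - _) * e]mulrBl ee -[_ * w * e]mulrA we.
have fT : f * T = T.
  by rewrite /T 2!mulrA [f * (f - _)]mulrBr ff [f * (w * _)]mulrA fw.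
have fwT : (f - w * star w) * T = T.
  rewrite /T !mulrA; congr (_ * _ * _).
  by rewrite mulrBl !mulrBr ff mulrA fw -mulrA w'f mulrA www subrr subr0.
have starT : star T = star (e - star w * w) * (star x * (f - w * star w)).
  by rewrite /T !starM [star (f - _)]starB fst starM starK.
clearbody T.
have Qe : Q * e = Q.
  apply: bop_ext => z; apply/subr0_eq/hnorm_eq0; rewrite bopM -bop_xB nQT.
  by rewrite bop_xB -bopM Te subrr hnorm0.
have eQ : e * Q = Q by have := congr1 (@star _ _) Qe; rewrite starM est Qst.
pose G' := [set p | exists a b z, G (a, b) /\ p = (a + Q z, b + T z)].
have G'i : invariant_graph G'.
  split.
  - move=> k _ _ _ _ [a [b [z [Gab [-> ->]]]]] [a' [b' [z' [Gab' [-> ->]]]]].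
    exists (k *: a + a'), (k *: b + b'), (k *: z + z').
    split; first exact: invariant_graphP.
    by rewrite !bop_linear !scalerDr; congr (_, _); rewrite addrACA.
  - move=> _ _ [a [b [z [Gab [-> ->]]]]].
    apply/eqP; rewrite -(eqrXn2 (ltn0Sn 1)) ?hnorm_ge0//.
    (* New pairs are orthogonal to old ones in both coordinates, so norms add by Pythagoras. *)
    have oQ : dot a (Q z) = 0.
      rewrite -star_dot Qst; have -> : Q a = 0.
        by apply: hnorm_eq0; rewrite nQT (domT _ _ Gab) hnorm0.
      exact: dot0l.
    have oT : dot b (T z) = 0.
      by rewrite -star_dot starT 2!bopM (ranT _ _ Gab) !bop_x0 dot0l.
    by rewrite (pythagoras oQ) (pythagoras oT) nQT
      (invariant_graph_norm Gi Gab).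
  - move=> _ _ [a [b [z [Gab [-> _]]]]].
    by rewrite bop_xD (invariant_graph_dom Gi Gab) -[e (Q z)]/((e * Q) z) eQ.
  - move=> _ _ [a [b [z [Gab [_ ->]]]]].
    by rewrite bop_xD (invariant_graph_ran Gi Gab) -[f (T z)]/((f * T) z) fT.
  - move=> s _ _ s_ [a [b [z [Gab [-> ->]]]]].
    exists (s a), (s b), (s z); split; first exact: invariant_graph_stable.
    have comm (q : bop V) : commutant S q -> s (q z) = q (s z).
      by move=> /(commutantP _ Ss)/(_ _ s_)/(congr1 (fun t : bop V => t z)).
    by rewrite !bop_xD (comm _ QS) (comm _ TS).
have /Gmax GG' := G'i.
have {}GG' : G' `<=` G.
  apply: GG' => -[a b] Gab; exists a, b, 0; split=> //.
  by rewrite !bop_x0 !addr0.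
apply: bop_ext => z; rewrite bop0.
(* By maximality [T z] lies in the range of [G], which [f - w * star w] annihilates; yet that
   operator fixes [T z]. *)
have : G (0 + Q z, 0 + T z) by apply: GG'; exists 0, 0, z; split=> //;
  exact: graph0.
move=> /ranT; rewrite add0r => <-.
exact: (congr1 (fun q : bop V => q z) (esym fwT)).
Qed.

End MaximalPartialIsometry.

(** * Tensor products and the amplification *)

Section AdjointCalculus.
Context {R : realType}.
Implicit Types U V W : hilbertType R.

Lemma adjK V W (T : V -> W) : bounded_op T -> adj (adj T) = T.
Proof. by move=> Tb; apply: adj_eq => v w; exact: adjP'. Qed.

Lemma adj_comp U V W (S : V -> W) (T : U -> V) : bounded_op S -> bounded_op T ->
  adj (S \o T) = adj T \o adj S.
Proof. by move=> Sb Tb; apply: adj_eq => v w /=; rewrite !adjP. Qed.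

Lemma dense_orthogonal V (S : set V) v : dense (lin_span S) ->
  (forall s, S s -> dot v s = 0) -> v = 0.
Proof.
move=> Sd vS; apply/hnorm_eq0/eqP; rewrite eq_le hnorm_ge0 andbT.
apply/ler_addgt0Pl => e e0; rewrite addr0.
have e0' : 0 < e%:C by rewrite ltcR.
have [|s [vs [n [a [b [Sb sE]]]]]] := Sd (ball v e%:C) _ (ball_open v e%:C).
  by exists v; exact: ballxx.
have vs0 : dot v s = 0.
  apply: dot_eq0C; rewrite sE dot_suml big1// => i _.
  by rewrite dotZl (dot_eq0C (vS _ (Sb i))) mulr0.
have {}vs : hnorm (v - s) < e by move: vs; rewrite -ball_normE /= hnormE ltcR.
have [->//|n0] := eqVneq (hnorm v) 0; first exact: ltW.
have n1 : 0 < hnorm v by rewrite lt_neqAle eq_sym n0 hnorm_ge0.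
rewrite -(ler_pM2l n1) -expr2 -Re_dot.
have -> : dot v v = dot v (v - s) by rewrite dotBr vs0 subr0.
apply: le_trans (Re_le_cabs _) _; apply: le_trans (cauchy_schwarz _ _) _.
by rewrite ler_wpM2l ?hnorm_ge0// ltW.
Qed.

End AdjointCalculus.

Section Tensor.
Context {R : realType} {H K L : hilbertType R}.
Variables (t : H -> K -> L).
Hypothesis tT : hilbert_tensor t.
Implicit Types (h : H) (k : K) (v : L).

Lemma hnorm_tensor h k : hnorm (t h k) = hnorm h * hnorm k.
Proof.
apply/eqP; rewrite -(eqrXn2 (ltn0Sn 1)) ?mulr_ge0 ?hnorm_ge0//.
by apply/eqP/complexI; rewrite -dotE (tensor_dot tT) !dotE -realCM exprMn.
Qed.

Lemma bounded_tensorr h : bounded_op (t h).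
Proof.
apply/bounded_opP; split; first exact: tensor_linearr tT h.
exists (hnorm h + 1); first by rewrite ltr_wpDl// hnorm_ge0.
by move=> k; rewrite hnorm_tensor ler_wpM2r ?hnorm_ge0// lerDl.
Qed.

Lemma bounded_tensorl k : bounded_op (t ^~ k).
Proof.
apply/bounded_opP; split; first exact: tensor_linearl tT k.
exists (hnorm k + 1); first by rewrite ltr_wpDl// hnorm_ge0.
by move=> h; rewrite hnorm_tensor mulrC ler_wpM2r ?hnorm_ge0// lerDl.
Qed.

(** So [adj (t h)] is a slice map, and [adj (t h) \o T \o t h'] plays the role of a matrix entry of
    [T]. *)
Lemma adj_tensor h h' k : adj (t h) (t h' k) = dot h' h *: k.
Proof.
apply: dot_inj => x; rewrite adjP'; last exact: bounded_tensorr.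
by rewrite (tensor_dot tT) dotZl.
Qed.

Lemma tensor_orthogonal v : (forall h k, dot v (t h k) = 0) -> v = 0.
Proof.
move=> vt; apply: (dense_orthogonal (tensor_dense tT)) => _ [h [k ->]].
exact: vt.
Qed.

Lemma tensor_ext (W : hilbertType R) (S T : L -> W) : bounded_op S ->
  bounded_op T -> (forall h k, S (t h k) = T (t h k)) -> S = T.
Proof.
move=> Sb Tb ST; apply/funext => v; apply: dot_inj => w; rewrite !adjP//.
suff -> : adj S w = adj T w by [].
apply/subr0_eq/tensor_orthogonal => h k.
by rewrite dotBl !adjP'// ST subrr.
Qed.

Variable M : set (K -> K).

Definition tensor_generators : set (L -> L) :=
  [set T | bounded_op T /\
    exists x y, [/\ bounded_op x, M y & tensor_op t x y T]].

Hypothesis Mvn : von_neumann_algebra M.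

Lemma vn_star_closed : star_closed M.
Proof. by case: Mvn => Mb Mst _; split. Qed.

Let Ms := vn_star_closed.
Let M's := commutant_star_closed Ms.

Lemma vnE : M = commutant (commutant M).
Proof. by case: Mvn. Qed.

Lemma tensor_generators_star_closed : star_closed tensor_generators.
Proof.
split=> [T []//|T [Tb [x [y [xb My xyT]]]]]; split; first exact: bounded_adj.
have yb := Ms.1 _ My.
exists (adj x), (adj y); split; [exact: bounded_adj|exact: Ms.2|] => h k.
apply/subr0_eq/tensor_orthogonal => h' k'.
by rewrite dotBl adjP'// xyT !(tensor_dot tT) -!adjP'// subrr.
Qed.

Let Gs := tensor_generators_star_closed.
Let G's := commutant_star_closed Gs.

Lemma amplification_star_closed : star_closed (amplification t M).
Proof. exact: commutant_star_closed. Qed.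

Lemma tensor_generators_amplification :
  tensor_generators `<=` amplification t M.
Proof.
move=> T GT; split; first by case: GT.
by move=> S [_ /(_ _ GT)].
Qed.

(** This is the elementary tensor of the rank one operator [g |-> dot g h *: h'] with [y]. *)
Lemma amplification_rank_one h h' y : M y ->
  amplification t M (t h' \o y \o adj (t h)).
Proof.
move=> My; have yb := Ms.1 _ My.
apply: tensor_generators_amplification; split.
  apply: bounded_comp; last exact/bounded_adj/bounded_tensorr.
  by apply: bounded_comp => //; exact: bounded_tensorr.
exists (fun g => dot g h *: h'), y; split=> //.
  apply/bounded_opP; split=> [a u v|].
    by rewrite dotDl dotZl scalerDl scalerA.
  exists (hnorm h * hnorm h' + 1);
    first by rewrite ltr_wpDl// mulr_ge0 ?hnorm_ge0.
  move=> v; rewrite hnormZ.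
  apply: le_trans (ler_wpM2r (hnorm_ge0 _) (cauchy_schwarz _ _)) _.
  by rewrite -mulrA [leLHS]mulrC mulrDl mul1r lerDl hnorm_ge0.
move=> g k /=; rewrite adj_tensor (linear_opZ _ _ (bounded_linear yb)).
rewrite (linear_opZ _ _ (bounded_linear (bounded_tensorr _))).
by rewrite (linear_opZ _ _ (bounded_linear (bounded_tensorl _))).
Qed.

Lemma tensor_isometry (u : bop K) : commutant M u -> star u * u = 1 ->
  exists W : bop L, commutant tensor_generators W /\
    forall h k, W (t h k) = t h (u k).
Proof.
move=> uM uu.
pose sub (D : set (L * L)) := D (0, 0) /\
  forall (a : R[i]) x y x' y', D (x, y) -> D (x', y') ->
    D (a *: x + x', a *: y + y').
(* The span of the pairs, as the intersection of all subspaces containing them: a property of [G] is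
   proved by choosing [D], once in each argument for the inner product. *)
pose G : set (L * L) := [set p | forall D, sub D ->
  (forall h k, D (t h k, t h (u k))) -> D p].
have Ggen h k : G (t h k, t h (u k)) by move=> D _; exact.
have Gdot p q : G p -> G q -> dot p.1 q.1 = dot p.2 q.2.
  move=> Gp Gq; apply: (Gp [set p | dot p.1 q.1 = dot p.2 q.2]).
    split=> [/=|a x y x' y' /= E E']; first by rewrite !dot0l.
    by rewrite !dotDl !dotZl E E'.
  move=> h k; apply: (Gq [set q | dot (t h k) q.1 = dot (t h (u k)) q.2]).
    split=> [/=|a x y x' y' /= E E']; first by rewrite !dot0r.
    by rewrite !dotDr !dotZr E E'.
  move=> h' k' /=; rewrite !(tensor_dot tT); congr (_ * _).
  by rewrite [RHS]dot_star -bopM uu.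
have Gi : isometric_graph G.
  split=> [D []//|a x y x' y' Gxy Gxy' D Ds Dg|x y Gxy].
    by apply: Ds.2; [exact: Gxy|exact: Gxy'].
  apply/eqP; rewrite -(eqrXn2 (ltn0Sn 1)) ?hnorm_ge0// -!Re_dot.
  by have /= -> := Gdot _ _ Gxy Gxy.
have [W [WG _ _ _]] := partial_isometry_of_graph Gi.
have WE h k : W (t h k) = t h (u k) by exact: WG.
exists W; split=> //; split; first exact: bop_bounded.
move=> T [Tb [x [y [xb My xyT]]]]; apply: tensor_ext.
- exact: bounded_comp (bop_bounded W) Tb.
- exact: bounded_comp Tb (bop_bounded W).
- move=> h k /=; rewrite xyT !WE xyT; congr (t _ _).
  by have [_ /(_ _ My)] := uM => /(congr1 (@^~ k)).
Qed.

(* For an isometry [u] in the commutant of [M], [1 (x) u] is bounded as the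
   extension of an isometric relation, and commutes with the amplification. The
   isometries [s +- i sqrt (1 - s^2)] span the commutant. *)
Lemma amplification_entry (T : L -> L) h h' : amplification t M T ->
  M (adj (t h) \o T \o t h').
Proof.
move=> TA; have Tb := commutant_bounded TA.
have [thb th'b] := (bounded_tensorr h, bounded_tensorr h').
have Eb : bounded_op (adj (t h) \o T \o t h').
  by do 2![apply: bounded_comp => //]; exact: bounded_adj.
pose E := Bop Eb; rewrite vnE; apply/(@commutantP _ _ _ E) => //.
pose P (s : bop K) := forall k, E (s k) = s (E k).
have isoP (u : bop K) : commutant M u -> star u * u = 1 -> P u.
  move=> uM uu k; have [W [WG WE]] := tensor_isometry uM uu.
  rewrite /= -WE; have [_ /(_ _ WG)] := TA => /(congr1 (@^~ (t h' k))) /= ->.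
  (* [T] commutes with [W = 1 (x) u], and slice maps intertwine [W] with [u]. *)
  suff /(congr1 (@^~ (T (t h' k)))) : adj (t h) \o W = u \o adj (t h) by [].
  apply: tensor_ext.
  - by apply: bounded_comp (bop_bounded W); exact: bounded_adj.
  - by apply: bounded_comp (bop_bounded u) _; exact: bounded_adj.
  - by move=> g l /=; rewrite WE !adj_tensor bop_xZ.
have PD a b : P a -> P b -> P (a + b).
  by move=> Pa Pb k; rewrite !bopD bop_xD Pa Pb.
have PM a b : P a -> P b -> P (a * b).
  by move=> Pa Pb k; rewrite !bopM Pa Pb.
have Pk c : P (bscale K c).
  by move=> k; rewrite !bscaleE bop_xZ.
pose b := bscale K 'i%C.
have bb : b * b = -1.
  rewrite /b bscaleM -expr2 sqr_i; apply: bop_ext => x.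
  by rewrite bscaleE scaleN1r bopN bop1.
have bst : star b = - b.
  apply: star_eq => x y; rewrite /b bopN !bscaleE dotNr dotZl dotZr -mulNr.
  by congr (_ * _); apply/eqP; rewrite eq_complex /= opprK oppr0 !eqxx.
have bC a : b * a = a * b := bscale_comm _ a.
have halfK (a : bop K) : bscale K 2^-1 * (a + a) = a.
  apply: bop_ext => x; rewrite bopM bscaleE bopD scalerDr -scalerDl.
  by rewrite -[RHS]scale1r; congr (_ *: _); field.
have contrP (s : bop K) : commutant M s -> star s = s -> contraction s -> P s.
  move=> sM sst sc.
  have [||Q [Qst QQ QS]] := @sqrt_exists _ _ (s * s).
  - by rewrite starM sst.
  - by move=> k; apply: le_trans (sc _) _; exact: sc.
  have QM : commutant M Q.
    apply/commutantP => // m Mm; apply: QS.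
    by have /commutantP := commutantM Ms sM sM; apply.
  have sQ : s * Q = Q * s by apply: QS; rewrite mulrA.
  have half (q : bop K) : commutant M q -> star q = q -> s * q = q * s ->
      q * q = 1 - s * s -> P (s + b * q).
    move=> qM qst sq qq; apply: isoP.
      by apply: commutantD => //; apply: commutantM => //;
        exact: commutant_scale.
    rewrite starD starM sst qst bst mulrN -bC mulrDr !mulrBl mulrA -bC -!mulrA.
    rewrite sq [q * (b * q)]mulrA -bC -mulrA qq [b * (b * _)]mulrA bb mulN1r.
    by rewrite opprK addrA subrK addrC subrK.
  have -> : s = bscale K 2^-1 * ((s + b * Q) + (s + b * (- Q))).
    by rewrite mulrN addrACA subrr addr0 halfK.
  apply: (PM) => //; apply: (PD); apply: (half) => //.
  - exact: commutantN.
  - by rewrite starN Qst.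
  - by rewrite mulrN mulNr sQ.
  - by rewrite mulrNN.
have saP (s : bop K) : commutant M s -> star s = s -> P s.
  move=> sM sst; have /bounded_opP[_ [c c0 sc]] := bop_bounded s.
  have -> : s = bscale K c%:C * (bscale K c^-1%:C * s).
    by rewrite mulrA bscaleM -realCM mulfV ?gt_eqF// bscale1 mul1r.
  apply: (PM) => //; apply: contrP.
  - by apply: commutantM => //; exact: commutant_scale.
  - by rewrite starM sst star_bscale_real bscale_comm.
  - move=> x; rewrite bopM bscaleE hnormZ cabs_real gtr0_norm ?invr_gt0//.
    by rewrite mulrC ler_pdivrMr// mulrC.
have allP (s : bop K) : commutant M s -> P s.
  move=> sM; have s'M := commutant_star Ms sM.
  (* Cartesian decomposition: [s + star s] and [b * (s - star s)], with [b] multiplication by ['i],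
     are self-adjoint. *)
  have -> : s = bscale K 2^-1 * ((s + star s) + (- b) * (b * (s - star s))).
    by rewrite mulrA mulNr bb opprK mul1r addrACA subrr addr0 halfK.
  have Pb : P (- b).
    have -> : - b = bscale K (- 'i%C) by apply: bop_ext => x;
      rewrite /b bopN !bscaleE scaleNr.
    exact: Pk.
  apply: (PM) => //; apply: (PD).
    by apply: (saP); [exact: commutantD|rewrite starD starK addrC].
  apply: (PM) => //; apply: (saP).
    by apply: commutantM; [|exact: commutant_scale|exact: commutantB].
  by rewrite starM starB starK bst mulrN -mulNr opprB bC.
by move=> s /allP Ps; apply: bop_ext => k; rewrite !bopM Ps.
Qed.

End Tensor.

(** * Orthogonality in a factor and in its amplification *)

Section FactorOrthogonality.
Context {R : realType} {H K L : hilbertType R}.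
Variables (t : H -> K -> L) (M : set (K -> K)).
Hypotheses (tT : hilbert_tensor t) (Mf : factor_algebra M).

Let Mvn : von_neumann_algebra M := Mf.1.
Let Ms := vn_star_closed Mvn.
Let M's := commutant_star_closed Ms.

(* The projection onto the common kernel of all [a * y] is central. *)
Lemma factor_orthogonal (a b : bop K) : M a -> M b ->
  (forall y : bop K, M y -> a * y * b = 0) -> a = 0 \/ b = 0.
Proof.
move=> Ma Mb ayb.
pose D := [set x : K | forall y : bop K, M y -> a (y x) = 0].
pose G := [set p : K * K | p.1 = p.2 /\ D p.1].
have Gi : isometric_graph G.
  split=> [|k x y x' y' [/= <- Dx] [/= <- Dx']|x y [/= <-]//].
    by split=> //= y My; rewrite !bop_x0.
  by split=> //= z Mz; rewrite !bop_linear Dx// Dx'// scaler0 addr0.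
have [W [WG W'G Wlim Wcomm]] := partial_isometry_of_graph Gi.
have GM (s : bop K) : M s -> forall x y, G (x, y) -> G (s x, s y).
  move=> Mss x _ [/= <- Dx]; split=> //= y My.
  by apply: (Dx (y * s)); rewrite (vnE Mvn); apply: commutantM => //;
    rewrite -(vnE Mvn).
have GM' (s : bop K) : commutant M s -> forall x y, G (x, y) -> G (s x, s y).
  move=> Mss x _ [/= <- Dx]; split=> //= y My.
  have comm z : M z -> forall x, z (s x) = s (z x).
    by case: Mss => _ ms /ms /[swap] x' /(congr1 (@^~ x')).
  by rewrite (comm _ My) (comm _ Ma) Dx// bop_x0.
have WM : (M `&` commutant M) W.
  split.
    rewrite (vnE Mvn); apply/commutantP => // s M's'.
    apply: Wcomm; apply: GM' => //; exact: commutant_star.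
  apply/commutantP => // s Mss; apply: Wcomm; apply: GM => //.
  exact: star_closed_star.
case: Mf => _ Mc; move: WM; rewrite Mc => -[c Wc].
have [b0|b0] := pselect (b = 0); [by right|left].
have [x bx] : exists x, b x <> 0.
  apply: contrapT => nb; apply: b0; apply: bop_ext => x.
  by apply: contrapT => bx; apply: nb; exists x.
have WE z : W z = c *: z by rewrite Wc.
have Dbx : D (b x).
  by move=> y My; have /(congr1 (fun q : bop K => q x)) := ayb _ My.
have c1 : c = 1.
  have : W (b x) = b x by apply: WG.
  rewrite WE => /eqP; rewrite -subr_eq0 -[X in _ - X]scale1r -scalerBl
    scaler_eq0.
  by move=> /orP[|/eqP//]; rewrite subr_eq0 => /eqP.
(* The central projection is [1] since it fixes the nonzero vector [b x]; so [D] is dense, and [a]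
   vanishes on it by the choice [y = 1]. *)
apply: bop_ext => z; have [u [v [Guv up vp]]] := Wlim z.
move: vp; rewrite WE c1 scale1r => /(bounded_cvg (bop_bounded a)) H1.
apply: (hcvg_unique H1); have -> : (fun n => a (v n)) = (fun=> 0).
  apply/funext => n; have [/= <- Du] := Guv n; apply: (Du 1).
  by rewrite (vnE Mvn); exact: commutant1.
exact: hcvg_cst.
Qed.

(** If [f] and [e] were nonzero they would have nonzero matrix entries [a] and [b] in [M]. Testing
    with rank one operators tensored with [y] gives [a * y * b = 0] for every [y] in [M], which a
    factor excludes. *)
Lemma amplification_orthogonal (f e : bop L) :
  amplification t M f -> amplification t M e ->
  (forall x : bop L, amplification t M x -> f * x * e = 0) -> f = 0 \/ e = 0.
Proof.
move=> Af Ae fxe.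
have entry0 (a : bop L) : (forall h h', adj (t h) \o a \o t h' = 0) -> a = 0.
  move=> a0; suff E : a = 0 :> (L -> L) by apply: bop_ext => v; rewrite E.
  apply: (tensor_ext tT (bop_bounded a) (bounded0 L L)) => h k.
  apply: (tensor_orthogonal tT) => h' k'.
  rewrite -adjP'; last exact: bounded_tensorr tT _.
  by have /(congr1 (@^~ k)) /= -> := a0 h' h; rewrite dot0l.
have [[h1 [h2 b0]]|nb] := pselect (exists h h', adj (t h) \o e \o t h' <> 0);
  last first.
  right; apply: entry0 => h h'; apply: contrapT => b0; apply: nb;
    by exists h, h'.
have [[h3 [h4 a0]]|na] := pselect (exists h h', adj (t h) \o f \o t h' <> 0);
  last first.
  left; apply: entry0 => h h'; apply: contrapT => a0; apply: na;
    by exists h, h'.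
have Mb := amplification_entry tT Mvn h1 h2 Ae.
have Ma := amplification_entry tT Mvn h3 h4 Af.
pose b := Bop (Ms.1 _ Mb); pose a := Bop (Ms.1 _ Ma).
have [|a0'|b0'] := @factor_orthogonal a b Ma Mb; last 2 first.
- by case: a0; have := congr1 (@bop_fun _ _) a0'.
- by case: b0; have := congr1 (@bop_fun _ _) b0'.
move=> y My; have Ax := amplification_rank_one tT Mvn h1 h4 My.
have Asc := amplification_star_closed tT Mvn.
have E := fxe (Bop (Asc.1 _ Ax)) Ax; apply: bop_ext => k.
have /= E2 := congr1 (fun q : bop L => q (t h2 k)) E.
by rewrite /= E2 (linear_op0
  (bounded_linear (bounded_adj (bounded_tensorr tT _)))).
Qed.

End FactorOrthogonality.

(** * The trace *)

Section TraceState.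
Context {R : realType} {K : hilbertType R}.
Variables (M : set (K -> K)) (tau : (K -> K) -> R[i]).
Hypotheses (Mvn : von_neumann_algebra M).
Hypothesis tauP : faithful_normal_tracial_state M tau.
Implicit Types (S T : K -> K).

Let Ms := vn_star_closed Mvn.
Let M's := commutant_star_closed Ms.

Lemma vnD S T : M S -> M T -> M (S + T).
Proof.
move=> MS MT; have [Sb Tb] := (Ms.1 _ MS, Ms.1 _ MT).
rewrite (vnE Mvn) in MS MT *.
exact: (@commutantD _ _ _ M's (Bop Sb) (Bop Tb)).
Qed.

Lemma vnN T : M T -> M (- T).
Proof.
move=> MT; have Tb := Ms.1 _ MT; rewrite (vnE Mvn) in MT *.
exact: (@commutantN _ _ _ M's (Bop Tb)).
Qed.

Lemma vn_comp S T : M S -> M T -> M (S \o T).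
Proof.
move=> MS MT; have [Sb Tb] := (Ms.1 _ MS, Ms.1 _ MT).
rewrite (vnE Mvn) in MS MT *.
exact: (@commutantM _ _ _ M's (Bop Sb) (Bop Tb)).
Qed.

Lemma vn0 : M 0.
Proof. by rewrite (vnE Mvn); exact: (commutant0 M's). Qed.

Lemma tauD S T : M S -> M T -> tau (S + T) = tau S + tau T.
Proof. by move=> MS MT; have := trace_linear tauP 1 MS MT;
  rewrite scale1r mul1r. Qed.

Lemma tau0 : tau 0 = 0.
Proof. by have := tauD vn0 vn0; rewrite addr0 => /esym/eqP;
  rewrite -subr_eq0 addrK => /eqP. Qed.

Lemma tauN T : M T -> tau (- T) = - tau T.
Proof.
move=> MT; apply/eqP; rewrite eq_sym eqr_oppLR -subr_eq0 opprK.
by rewrite -tauD//; [rewrite subrr tau0|exact: vnN].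
Qed.

Lemma tauB S T : M S -> M T -> tau (S - T) = tau S - tau T.
Proof. by move=> MS MT; rewrite tauD ?tauN//; exact: vnN. Qed.

Section Gram.
Variables (W : hilbertType R) (Z : K -> W).
Hypotheses (Zb : bounded_op Z) (MZ : M (adj Z \o Z)).

(** The trace axioms concern [adj T \o T] with [T] in [M], whereas the operators of interest map [K]
    to another space; their modulus lies in [M]. *)
Lemma gram_modulus : exists Q : bop K,
  [/\ M Q, adj Z \o Z = adj Q \o Q & forall x, hnorm (Q x) = hnorm (Z x)].
Proof.
have [Q [Qst QQ QS]] := modulus_exists Zb.
have MQ : M Q.
  rewrite (vnE Mvn); apply/commutantP => // s Mss; apply: QS => x.
  by case: Mss => _ /(_ _ MZ)/(congr1 (@^~ x)).
have adjQ : adj Q = Q :> (K -> K) by have := congr1 (@bop_fun _ _) Qst.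
exists Q; split=> //; first by apply/funext => x /=; rewrite adjQ QQ.
move=> x; apply/eqP; rewrite -(eqrXn2 (ltn0Sn 1)) ?hnorm_ge0//.
by rewrite -!Re_dot dot_star Qst QQ -adjP.
Qed.

Lemma tau_gram_ge0 : 0 <= tau (adj Z \o Z).
Proof. by have [Q [MQ -> _]] := gram_modulus; exact: trace_pos tauP _ MQ. Qed.

Lemma tau_gram_eq0 : tau (adj Z \o Z) = 0 -> Z = 0.
Proof.
have [Q [MQ -> QZ]] := gram_modulus => /(trace_faithful tauP MQ) Q0.
apply/funext => x; apply: hnorm_eq0.
by rewrite -QZ Q0 hnorm0.
Qed.

End Gram.

Definition retau S : R := complex.Re (tau S).

Lemma retauD S T : M S -> M T -> retau (S + T) = retau S + retau T.
Proof. by move=> MS MT; rewrite /retau tauD// raddfD. Qed.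

Lemma retauB S T : M S -> M T -> retau (S - T) = retau S - retau T.
Proof. by move=> MS MT; rewrite /retau tauB// raddfB. Qed.

Lemma retau_gram_ge0 (W : hilbertType R) (Z : K -> W) : bounded_op Z ->
  M (adj Z \o Z) -> 0 <= retau (adj Z \o Z).
Proof.
move=> Zb MZ; have := tau_gram_ge0 Zb MZ.
by rewrite lecE => /andP[_].
Qed.

Lemma tau_gramE (W : hilbertType R) (Z : K -> W) : bounded_op Z ->
  M (adj Z \o Z) -> tau (adj Z \o Z) = (retau (adj Z \o Z))%:C.
Proof. by move=> Zb MZ; rewrite RRe_real// ger0_real// tau_gram_ge0. Qed.

Lemma retau_gram_eq0 (W : hilbertType R) (Z : K -> W) : bounded_op Z ->
  M (adj Z \o Z) -> retau (adj Z \o Z) = 0 -> Z = 0.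
Proof. by move=> Zb MZ Z0; apply: tau_gram_eq0 => //;
  rewrite tau_gramE// Z0. Qed.

End TraceState.

(** * Expansion along an orthonormal basis of the first tensor factor *)

Section Basis.
Context {R : realType} {H K L : hilbertType R}.
Variables (t : H -> K -> L) (e : nat -> H).
Hypotheses (tT : hilbert_tensor t) (eB : orthonormal_basis e).
Implicit Types (v w : L).

Let c i v : K := adj (t (e i)) v.

Let tb i : bounded_op (t (e i)) := bounded_tensorr tT (e i).
Let cb i : bounded_op (c i) := bounded_adj (tb i).

Definition basis_proj n v : L := \sum_(i < n) t (e i) (c i v).

Lemma basis_projS n v : basis_proj n.+1 v = basis_proj n v + t (e n) (c n v).
Proof. exact: big_ord_recr. Qed.

Lemma bounded_basis_proj n : bounded_op (basis_proj n).
Proof.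
elim: n => [|n IH].
  have -> : basis_proj 0 = 0 by apply/funext => v; rewrite /basis_proj big_ord0.
  exact: bounded0.
have -> : basis_proj n.+1 = basis_proj n + (t (e n) \o c n).
  by apply/funext => v; rewrite basis_projS.
by apply: boundedD => //; exact: bounded_comp.
Qed.

Lemma coord_tensor i j k : c i (t (e j) k) = (j == i)%:R *: k.
Proof. by rewrite /c adj_tensor// eB.1. Qed.

Lemma coord_basis_proj i n v : c i (basis_proj n v) = (i < n)%:R *: c i v.
Proof.
elim: n => [|n IH].
  by rewrite /basis_proj big_ord0 (linear_op0 (bounded_linear (cb i))) scale0r.
rewrite basis_projS (linear_opD _ _ (bounded_linear (cb i))) IH coord_tensor.
rewrite ltnS; case: (ltngtP i n) => [_|_|->] /=.
- by rewrite scale0r addr0.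
- by rewrite !scale0r addr0.
- by rewrite scale0r add0r.
Qed.

Lemma dot_basis_proj n v w :
  dot (basis_proj n v) w = \sum_(i < n) dot (c i v) (c i w).
Proof. by rewrite dot_suml; apply: eq_bigr => i _; rewrite adjP. Qed.

Lemma dot_basis_proj2 m n v w : (n <= m)%N ->
  dot (basis_proj n v) (basis_proj m w) = dot (basis_proj n v) w.
Proof.
move=> nm; rewrite !dot_basis_proj; apply: eq_bigr => i _.
by rewrite coord_basis_proj (leq_trans (ltn_ord i) nm) scale1r.
Qed.

Lemma dot_basis_projr n v w :
  dot v (basis_proj n w) = dot (basis_proj n v) w.
Proof. by rewrite dotC -(dot_basis_proj2 _ _ (leqnn n)) -dotC dot_basis_proj2
  1?dotC// -dotC. Qed.

Let s n v : R := \sum_(i < n) hnorm (c i v) ^+ 2.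

Lemma sqr_basis_proj n v : dot (basis_proj n v) v = (s n v)%:C.
Proof.
rewrite dot_basis_proj /s rmorph_sum; apply: eq_bigr => i _; exact: dotE.
Qed.

Lemma hnorm_basis_proj n v : hnorm (basis_proj n v) ^+ 2 = s n v.
Proof. by rewrite -Re_dot dot_basis_proj2// sqr_basis_proj. Qed.

Lemma hnorm_basis_projB m n v : (n <= m)%N ->
  hnorm (basis_proj m v - basis_proj n v) ^+ 2 = s m v - s n v.
Proof.
move=> nm; rewrite hdistC hnorm_sqrB dot_basis_proj2// sqr_basis_proj.
by rewrite !hnorm_basis_proj /=; ring.
Qed.

Lemma bessel n v : s n v <= hnorm v ^+ 2.
Proof.
have : 0 <= hnorm (v - basis_proj n v) ^+ 2 by rewrite exprn_ge0// hnorm_ge0.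
rewrite hdistC hnorm_sqrB sqr_basis_proj hnorm_basis_proj /=; lra.
Qed.

(** Bessel's inequality makes the sequence Cauchy. The difference between [v] and the limit has zero
    coordinates along [e], and density of the span of [e] makes it orthogonal to all elementary
    tensors. *)
Lemma basis_proj_cvg v : basis_proj^~ v @ \oo --> v.
Proof.
have s_incr m n : (n <= m)%N -> s n v <= s m v.
  by move=> /(hnorm_basis_projB v) E;
    rewrite -subr_ge0 -E exprn_ge0// hnorm_ge0.
have sc : cvg ((s ^~ v) @ \oo).
  apply: nondecreasing_is_cvgn; first by move=> n m; exact: s_incr.
  by exists (hnorm v ^+ 2) => _ [n _ <-]; exact: bessel.
have [v' v'P] : exists v', basis_proj^~ v @ \oo --> v'.
  apply: hcauchy_cvg => r r0.
  have r1 : 0 < r ^+ 2 / 2 by rewrite divr_gt0 ?exprn_gt0.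
  have /cvgrPdist_lt /(_ _ r1) [N _ HN] := sc.
  have close m n : (N <= m)%N -> (N <= n)%N -> (n <= m)%N ->
      hnorm (basis_proj m v - basis_proj n v) < r.
    move=> Nm Nn nm; rewrite -(ltr_pXn2r (ltn0Sn 1)) ?nnegrE ?hnorm_ge0
      ?(ltW r0)//.
    rewrite hnorm_basis_projB//.
    have := HN _ Nm; have := HN _ Nn;
      rewrite /= !ltr_norml => /andP[A B] /andP[C D].
    lra.
  exists N => m n Nm Nn; have [nm|/ltnW mn] := leqP n m; first exact: close.
  by rewrite hdistC; exact: close.
suff vv' : v - v' = 0 by rewrite [X in _ --> X](subr0_eq vv').
apply: (tensor_orthogonal tT) => h k.
have tkb := bounded_tensorl tT k.
rewrite -[LHS]/(dot (v - v') ((t ^~ k) h)) -(adjP' tkb).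
suff -> : adj (t ^~ k) (v - v') = 0 by rewrite dot0l.
apply: (dense_orthogonal eB.2) => _ [j _ <-]; rewrite adjP'//.
(* The shift by [j.+1] ensures that the [j]-th coordinate is already removed in every term. *)
have wP : (fun n => v - basis_proj (n + j.+1) v) @ \oo --> v - v'.
  apply: cvgB; first exact: cvg_cst.
  by have := v'P; rewrite -(cvg_shiftn j.+1 (basis_proj^~ v)).
rewrite -(dot0l (0 : L)).
apply: (hcvg_dot_eq wP (@hcvg_cst _ _ _) (@hcvg_cst _ _ _) (@hcvg_cst _ _ _))
  => n.
rewrite dot0l -adjP'; last exact: tb.
rewrite -/(c j _) (linear_opB _ _ (bounded_linear (cb j))) coord_basis_proj.
by rewrite ltn_addl// scale1r subrr dot0l.
Qed.

Lemma parseval_le v (b : R) : (forall n, s n v <= b) -> hnorm v ^+ 2 <= b.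
Proof.
move=> sb; have nP := hcvg_norm (@basis_proj_cvg v).
have n2P := cvgM nP nP; rewrite expr2.
apply: (ler_cvg_to (n2P _) (cvg_cst b)); apply: nearW => n.
by rewrite /= -expr2 hnorm_basis_proj.
Qed.

End Basis.

(** * The amplified trace and its independence of the basis *)

Section TraceSeries.
Context {R : realType} {H K L : hilbertType R}.
Variables (t : H -> K -> L) (M : set (K -> K)) (tau : (K -> K) -> R[i]).
Hypotheses (tT : hilbert_tensor t) (Mvn : von_neumann_algebra M).
Hypothesis tauP : faithful_normal_tracial_state M tau.

Let Ms := vn_star_closed Mvn.

Section Series.
Variables (e : nat -> H) (Z : K -> L).
Hypotheses (eB : orthonormal_basis e) (Zb : bounded_op Z).
Hypothesis MZ : M (adj Z \o Z).
Hypothesis MeZ : forall i, M (adj (t (e i)) \o Z).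

Let m i : K -> K := adj (t (e i)) \o Z.
Let S n : K -> K := \sum_(i < n) (adj (m i) \o m i).

Let Mgram i : M (adj (m i) \o m i).
Proof. exact: (vn_comp Mvn (Ms.2 _ (MeZ i)) (MeZ i)). Qed.

Let mb i : bounded_op (m i) := Ms.1 _ (MeZ i).

Let SS n : S n.+1 = S n + (adj (m n) \o m n).
Proof. exact: big_ord_recr. Qed.

Let MS n : M (S n).
Proof.
elim: n => [|n IH]; first by rewrite /S big_ord0; exact: vn0.
by rewrite SS; exact: vnD.
Qed.

Let dotS n x y : dot (S n x) y = dot (basis_proj t e n (Z x)) (Z y).
Proof.
elim: n => [|n IH].
  by rewrite /S /basis_proj !big_ord0 !dot0l.
rewrite SS basis_projS !dotDl -IH; congr (_ + _).
by rewrite /= (adjP' (mb n)) /m /= (adjP (bounded_tensorr tT _)).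
Qed.

Let retauS n : retau tau (S n) = \sum_(i < n) retau tau (adj (m i) \o m i).
Proof.
elim: n => [|n IH]; first by rewrite /S !big_ord0 /retau (tau0 Mvn tauP).
by rewrite big_ord_recr SS (retauD tauP) ?IH.
Qed.

Let tauS n : tau (S n) = (retau tau (S n))%:C.
Proof.
elim: n => [|n IH]; first by rewrite /S !big_ord0 /retau (tau0 Mvn tauP).
by rewrite SS (retauD tauP)// (tauD tauP)// IH realCD (tau_gramE Mvn tauP)//.
Qed.

(** The gap is [adj Y \o Y], where [Y] is [Z] minus its first [n] basis components. *)
Let retauS_le n : retau tau (S n) <= retau tau (adj Z \o Z).
Proof.
pose Y : K -> L := Z - (basis_proj t e n \o Z).
have Yb : bounded_op Y.
  by apply: boundedB => //; apply: bounded_comp => //;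
    exact: bounded_basis_proj.
have YE : adj Z \o Z - S n = adj Y \o Y.
  apply/funext => x; apply: dot_inj => y.
  rewrite [(adj Y \o Y) x]/= (adjP' Yb) -[(_ - _) x]/(adj Z (Z x) - S n x).
  rewrite -[Y x]/(Z x - basis_proj t e n (Z x))
    -[Y y]/(Z y - basis_proj t e n (Z y)).
  rewrite dotBl (adjP' Zb) dotS dotBl !dotBr.
  by rewrite (dot_basis_projr tT eB) (dot_basis_proj2 tT eB)// subrr subr0.
rewrite -subr_ge0 -(retauB Mvn tauP)// YE.
apply: (retau_gram_ge0 Mvn tauP) => //; rewrite -YE.
by apply: vnD => //; exact: vnN.
Qed.

(** Normality of [tau]: the [S n] increase, and by Bessel and Parseval their least upper bound is
    [adj Z \o Z]. *)
Let retauS_sup (c : R) : (forall n, retau tau (S n) <= c) ->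
  retau tau (adj Z \o Z) <= c.
Proof.
move=> Sc; rewrite -lecR -(tau_gramE Mvn tauP)//.
have dotSE n x : dot (S n x) x =
    (\sum_(i < n) hnorm (adj (t (e i)) (Z x)) ^+ 2)%:C.
  by rewrite dotS sqr_basis_proj.
have dotZ x : dot ((adj Z \o Z) x) x = (hnorm (Z x) ^+ 2)%:C.
  by rewrite /= (adjP' Zb) dotE.
have Smono n m' x : (n <= m')%N -> dot (S n x) x <= dot (S m' x) x.
  move=> nm; rewrite !dotSE lecR -subr_ge0.
  by rewrite -(hnorm_basis_projB tT eB _ nm) exprn_ge0// hnorm_ge0.
apply: (trace_normal tauP (D := range S)).
- move=> _ [n _ <-]; split=> //= x; rewrite [X in dot X _](_ : _ = 0)// dot0l.
  by rewrite dotSE ler0c sumr_ge0// => i _; rewrite exprn_ge0// hnorm_ge0.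
- split; first by exists (S 0), 0%N.
  move=> _ _ [n _ <-] [k _ <-]; exists (S (maxn n k));
    first by exists (maxn n k).
  by split=> x; apply: Smono; rewrite ?leq_maxl ?leq_maxr.
- split=> // [_ [n _ <-] x|U MU SU x].
    by rewrite dotSE dotZ lecR; exact: (bessel tT eB).
  have SU' n : dot (S n x) x <= dot (U x) x by apply: SU; exists n.
  (* [U] dominates [S 0 = 0], so its quadratic form is real and can be compared in [R]. *)
  have UE : dot (U x) x = (complex.Re (dot (U x) x))%:C.
    rewrite RRe_real// ger0_real//; have := SU' 0%N.
    by rewrite dotSE big_ord0.
  rewrite dotZ UE lecR; apply: (parseval_le tT eB) => n.
  by rewrite -lecR -dotSE -UE.
- by move=> _ [n _ <-]; rewrite tauS lecR.
Qed.

Lemma retau_series : ((retau tau (adj Z \o Z))%:E =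
  \sum_(0 <= i <oo) (retau tau (adj (adj (t (e i)) \o Z) \o
     (adj (t (e i)) \o Z)))%:E)%E.
Proof.
have ge0 i : (0 <= (retau tau (adj (m i) \o m i))%:E)%E.
  by rewrite lee_fin; exact: (retau_gram_ge0 Mvn tauP).
have partial n : (\sum_(0 <= i < n) (retau tau (adj (m i) \o m i))%:E =
    (retau tau (S n))%:E)%E.
  by rewrite sumEFin big_mkord retauS.
apply/eqP; rewrite eq_le; apply/andP; split; last first.
  apply: lime_le; first by apply: is_cvg_nneseries => n _ _; exact: ge0.
  by apply: nearW => n; rewrite partial lee_fin.
have ple n : ((retau tau (S n))%:E <= \sum_(0 <= i <oo)
  (retau tau (adj (m i) \o m i))%:E)%E.
  by rewrite -partial; apply: nneseries_lim_ge.
move: ple; rewrite -/m; case: (limn _) => [c ple||ple].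
- by rewrite lee_fin; apply: retauS_sup => n; rewrite -lee_fin; exact: ple.
- by rewrite leey.
- by have := ple 0%N.
Qed.

End Series.

Let A := amplification t M.
Let Gs := tensor_generators_star_closed tT Mvn.
Let G's := commutant_star_closed Gs.

Implicit Types (X Y : bop L).

Definition atr (e : nat -> H) (X : bop L) : \bar R := amplified_trace t tau e X.

(** Positivity is recorded through the traces of diagonal entries, which is the form in which series
    of nonnegative terms consume it. *)
Definition trace_pos_op (X : bop L) : Prop :=
  A X /\ forall h, 0 <= retau tau (adj (t h) \o X \o t h).

Lemma trace_pos_gram (X : bop L) : A X -> trace_pos_op (star X * X).
Proof.
move=> AX; have AXX : A (star X * X).
  by apply: commutantM => //; exact: commutant_star.
split=> // h; have thb := bounded_tensorr tT h.
have Xtb : bounded_op (X \o t h) by apply: bounded_comp => //;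
  exact: bop_bounded.
have E : adj (X \o t h) \o (X \o t h) = adj (t h) \o (star X * X) \o t h.
  by rewrite (adj_comp (bop_bounded X) thb).
rewrite -E; apply: (retau_gram_ge0 Mvn tauP) => //.
by rewrite E; exact: (amplification_entry tT Mvn).
Qed.

Lemma entryD (X Y : bop L) h : adj (t h) \o (X + Y) \o t h =
  (adj (t h) \o X \o t h) + (adj (t h) \o Y \o t h).
Proof.
apply/funext => k; rewrite -[LHS]/(adj (t h) (X (t h k) + Y (t h k))).
by rewrite (linear_opD _ _
  (bounded_linear (bounded_adj (bounded_tensorr tT _)))).
Qed.

Lemma trace_posD X Y : trace_pos_op X -> trace_pos_op Y -> trace_pos_op (X + Y).
Proof.
move=> [AX X0] [AY Y0]; split=> [|h]; first exact: commutantD.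
by rewrite entryD (retauD tauP) ?addr_ge0//;
  exact: (amplification_entry tT Mvn).
Qed.

Lemma atr_ge0 e X : trace_pos_op X -> (0 <= atr e X)%E.
Proof. by move=> [_ X0]; apply: nneseries_ge0 => n _ _; rewrite lee_fin;
  exact: X0. Qed.

Lemma atrD e X Y : trace_pos_op X -> trace_pos_op Y ->
  (atr e (X + Y)%R = atr e X + atr e Y)%E.
Proof.
move=> [AX X0] [AY Y0]; rewrite /atr /amplified_trace -nneseriesD//.
- apply: eq_eseriesr => i _; rewrite -EFinD -(retauD tauP) -?entryD//;
  exact: (amplification_entry tT Mvn).
- by move=> n _ _; rewrite lee_fin; exact: X0.
- by move=> n _ _; rewrite lee_fin; exact: Y0.
Qed.

Lemma atr_gramE e X : atr e (star X * X) =
  (\sum_(0 <= i <oo) (retau tau (adj (X \o t (e i)) \o (X \o t (e i))))%:E)%E.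
Proof.
apply: eq_eseriesr => i _; congr (_%:E); congr (retau tau _).
by rewrite (adj_comp (bop_bounded X) (bounded_tensorr tT _)).
Qed.

(** Every term of the series vanishes, so by faithfulness of [tau] each column [X \o t (e i)] is
    zero. *)
Lemma atr_gram_eq0 e X : orthonormal_basis e -> A X ->
  atr e (star X * X) = 0%E -> X = 0.
Proof.
move=> eB AX; rewrite atr_gramE => X0.
have [_ pos] := trace_pos_gram AX.
have gramE i : adj (X \o t (e i)) \o (X \o t (e i)) =
    adj (t (e i)) \o (star X * X) \o t (e i).
  by rewrite (adj_comp (bop_bounded X) (bounded_tensorr tT _)).
have Xi i : X \o t (e i) = 0.
  have b : bounded_op (X \o t (e i)).
    by apply: bounded_comp; [exact: bop_bounded|exact: bounded_tensorr].
  apply: (retau_gram_eq0 Mvn tauP) => //.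
    rewrite gramE; apply: (amplification_entry tT Mvn) => //.
    by apply: commutantM => //; exact: commutant_star.
  apply/eqP; rewrite eq_le {2}gramE pos andbT -lee_fin -[leRHS]/(0%E)
    -[leRHS]X0.
  pose f k := (retau tau (adj (X \o t (e k)) \o (X \o t (e k))))%:E.
  have f0 k : (0 <= f k)%E by rewrite lee_fin gramE.
  have le1 : (f i <= \sum_(0 <= k < i.+1) f k)%E.
    by rewrite big_nat_recr//= leeDr// sume_ge0.
  by apply: (le_trans le1); exact: nneseries_lim_ge.
apply: bop_ext => v.
have := bounded_cvg (bop_bounded X) (basis_proj_cvg tT eB (v:=v)).
have -> : (fun n => X (basis_proj t e n v)) = (fun=> 0).
  apply/funext => n; rewrite /basis_proj (linear_op_sum _ (bop_linear X)).
  by apply: big1 => i _; exact: (congr1 (@^~ _) (Xi i)).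
by move=> H1; exact: (hcvg_unique H1 (@hcvg_cst _ _ _)).
Qed.

(* The matrix of [star X] is the adjoint of the matrix of [X]; comparing the
   rows for [e] with the columns for [e'] makes the trace basis-independent. *)
Lemma atr_gramC e e' X : orthonormal_basis e -> orthonormal_basis e' -> A X ->
  atr e (star X * X) = atr e' (X * star X).
Proof.
move=> eB eB' AX; have A'X : A (star X) by exact: commutant_star.
have -> : X * star X = star (star X) * star X by rewrite starK.
rewrite !atr_gramE.
have tb h := bounded_tensorr tT h.
have main (f g : nat -> H) (Y : bop L) : orthonormal_basis g -> A Y ->
   (\sum_(0 <= i <oo) (retau tau (adj (Y \o t (f i)) \o (Y \o t (f i))))%:E =
    \sum_(0 <= i <oo) \sum_(0 <= j <oo)
      (retau tau (adj (adj (t (g j)) \o (Y \o t (f i))) \o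
                 (adj (t (g j)) \o (Y \o t (f i)))))%:E)%E.
  move=> gB AY; apply: eq_eseriesr => i _.
  apply: retau_series => //.
  - by apply: bounded_comp => //; exact: bop_bounded.
  - rewrite (adj_comp (bop_bounded Y) (tb _)).
    apply: (amplification_entry tT Mvn _ _ (T := star Y * Y)).
    by apply: commutantM => //; exact: commutant_star.
  - by move=> j; exact: (amplification_entry tT Mvn).
rewrite (main e e' X)// (main e' e (star X))//.
rewrite nneseries_interchange; last first.
  move=> i j; rewrite lee_fin; apply: (retau_gram_ge0 Mvn tauP).
    exact: Ms.1 _ (amplification_entry tT Mvn (e' j) (e i) AX).
  have Mij := amplification_entry tT Mvn (e' j) (e i) AX.
  exact: (vn_comp Mvn (Ms.2 _ Mij) Mij).
(* Term by term the claim is [tau (adj m \o m) = tau (m \o adj m)]. *)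
apply: eq_eseriesr => i _; apply: eq_eseriesr => j _; congr (_%:E).
have Mm := amplification_entry tT Mvn (e' i) (e j) AX.
set m := adj (t (e' i)) \o (X \o t (e j)) in Mm *.
have mE : adj (t (e j)) \o (star X \o t (e' i)) = adj m.
  rewrite /m (adj_comp (bounded_adj (tb _))
    (bounded_comp (bop_bounded X) (tb _))).
  by rewrite (adj_comp (bop_bounded X) (tb _)) (adjK (tb _)).
by rewrite mE (adjK (Ms.1 _ Mm)) /retau (trace_comm tauP Mm (Ms.2 _ Mm)).
Qed.

End TraceSeries.

(** * The finite-trace ideal *)

Section FiniteTrace.
Context {R : realType} {H K L : hilbertType R}.
Variables (t : H -> K -> L) (M : set (K -> K)) (tau : (K -> K) -> R[i]).
Hypotheses (tT : hilbert_tensor t) (Mvn : von_neumann_algebra M).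
Hypothesis tauP : faithful_normal_tracial_state M tau.

Let A := amplification t M.
Let Minf := finite_trace_ideal t M tau.
Let S0 := commutant (tensor_generators t M).
Let S0s : star_closed S0 :=
  commutant_star_closed (tensor_generators_star_closed tT Mvn).

Implicit Types (X Y : bop L).

Local Notation pos := (trace_pos_gram tT Mvn tauP).

Lemma amplification_self_ideal : two_sided_ideal A A.
Proof.
have bA T (AT : A T) := commutant_bounded AT.
split=> //; first exact: (commutant0 S0s).
  by move=> T T' AT AT';
    exact: (@commutantD _ _ _ S0s (Bop (bA _ AT)) (Bop (bA _ AT'))).
move=> T T' AT AT'; split.
  exact: (@commutantM _ _ _ S0s (Bop (bA _ AT)) (Bop (bA _ AT'))).
exact: (@commutantM _ _ _ S0s (Bop (bA _ AT')) (Bop (bA _ AT))).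
Qed.

Lemma finite_trace_ideal_ideal : two_sided_ideal A Minf.
Proof.
split.
- move=> T; apply; split; first exact: amplification_self_ideal.
  by move=> p [].
- by move=> I [[_ I0 _ _] _].
- move=> T T' MT MT' I II; have [[_ _ ID _] _] := II.
  by apply: ID; [exact: MT|exact: MT'].
- by move=> T T' AT MT'; split=> I II; have [[_ _ _ IM] _] := II;
    have [] := IM _ _ AT (MT' _ II).
Qed.

(** A projection of finite trace comes with a basis; without one, [[set 0]] is already an ideal
    containing all such projections. *)
Lemma finite_trace_ideal_no_basis T :
  (forall e : nat -> H, ~ orthonormal_basis e) -> Minf T -> T = 0.
Proof.
move=> ne MT; apply: (MT [set 0]); split; last first.
  by move=> p [_ _ [e eB]]; case: (ne e).
split=> // [_ ->|_ _ -> ->|T1 _ AT1 ->]; first exact: (commutant0 S0s).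
  by apply/funext => v; rewrite /= addr0.
split=> //; apply/funext => v /=.
exact: (linear_op0 (bounded_linear (commutant_bounded AT1))).
Qed.

Section WithBasis.
Variable e : nat -> H.
Hypothesis eB : orthonormal_basis e.

(** Each of the infinitely many diagonal entries is [id], of trace 1. *)
Lemma atr1 : atr t tau e 1 = +oo%E.
Proof.
have one i : retau tau (adj (t (e i)) \o (1 : bop L) \o t (e i)) = 1.
  rewrite /retau; have -> : adj (t (e i)) \o (1 : bop L) \o t (e i) = id.
    by apply/funext => k /=; rewrite adj_tensor// eB.1 eqxx scale1r.
  by rewrite (trace_unit tauP).
rewrite /atr /amplified_trace.
have -> : (\sum_(0 <= i <oo)
  (complex.Re (tau (adj (t (e i)) \o (1 : bop L) \o t (e i))))%:E =
    \sum_(0 <= i <oo) (1 : \bar R))%E.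
  by apply: eq_eseriesr => i _; congr (_%:E); exact: one.
have H1 n : (n%:R%:E <= \sum_(0 <= i <oo) (1 : \bar R))%E.
  have <- : (\sum_(0 <= i < n) (1 : \bar R) = n%:R%:E)%E.
    by rewrite sumEFin big_mkord sumr_const card_ord.
  by apply: nneseries_lim_ge => i _ _; exact: lee01.
move: H1; case: (limn _) => [c H1|//|H1]; last by have := H1 0%N.
have := H1 (Num.truncn c).+1; rewrite lee_fin => /(lt_le_trans (truncnS_gt c)).
by rewrite ltxx.
Qed.

(** The Hilbert-Schmidt condition. It defines a two-sided ideal containing the finite projections,
    hence holds on the finite-trace ideal; on a projection it means finite trace. *)
Definition trace_fin X : Prop := (atr t tau e (star X * X)%R < +oo)%E.

(** With [Q * Q = 1 - star Y * Y], the operator [star X * X] is the sum of the squares of [Y * X]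
    and [Q * X]. *)
Lemma trace_fin_contraction X Y : A X -> A Y -> contraction Y ->
  trace_fin X -> trace_fin (Y * X).
Proof.
move=> AX AY Yc; have AY' := commutant_star S0s AY.
have [||Q [Qst QQ QS]] := @sqrt_exists _ _ (star Y * Y).
- by rewrite starM starK.
- move=> x; have [->|n0] := eqVneq (hnorm ((star Y * Y) x)) 0.
    exact: hnorm_ge0.
  have n1 : 0 < hnorm ((star Y * Y) x) by rewrite lt_neqAle eq_sym n0 hnorm_ge0.
  rewrite -(ler_pM2r n1) -expr2 -Re_dot {1}bopM star_dot.
  apply: le_trans (Re_le_cabs _) _; apply: le_trans (cauchy_schwarz _ _) _.
  apply: ler_pM; rewrite ?hnorm_ge0//; exact: Yc.
have AQ : A Q.
  apply/(commutantP _ S0s) => s S0s'; apply: QS.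
  by have /(commutantP _ S0s) := commutantM S0s AY' AY; apply.
have E : star X * X = star (Y * X) * (Y * X) + star (Q * X) * (Q * X).
  rewrite !starM Qst -!mulrA -mulrDr; congr (_ * _).
  by rewrite !mulrA -mulrDl QQ addrC subrK mul1r.
rewrite /trace_fin E (atrD tT Mvn tauP)//; last 2 first.
- by apply: pos; exact: (commutantM S0s).
- by apply: pos; exact: (commutantM S0s).
apply: le_lt_trans; rewrite leeDl//.
by apply: (atr_ge0 _ (M := M)); apply: pos; exact: (commutantM S0s).
Qed.

(** The parallelogram identity for [X + Y] and [X - Y], with the second square dropped. *)
Lemma trace_finD X Y : A X -> A Y -> trace_fin X -> trace_fin Y ->
  trace_fin (X + Y).
Proof.
move=> AX AY Xf Yf.
have AD := commutantD S0s AX AY; have AB := commutantB S0s AX AY.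
have E : star (X + Y) * (X + Y) + star (X - Y) * (X - Y) =
    (star X * X + star X * X) + (star Y * Y + star Y * Y).
  rewrite starD starB !mulrDl !mulrDr !mulNr !mulrN opprK.
  rewrite addrACA [_ + _ + (_ - _)]addrACA subrr addr0; congr (_ + _).
  by rewrite addrACA subrr add0r.
have posD Z Z' := trace_posD tT Mvn tauP (X := Z) (Y := Z').
have : (atr t tau e (star (X + Y) * (X + Y) + star (X - Y) * (X - Y))%R <
  +oo)%E.
  rewrite E !(atrD tT Mvn tauP)//; do ?[by apply: pos];
    do ?[by apply: posD; exact: pos].
  by rewrite !lte_add_pinfty.
rewrite (atrD tT Mvn tauP)//; do ?[by apply: pos].
apply: le_lt_trans; rewrite leeDl//.
by apply: (atr_ge0 _ (M := M)); exact: pos.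
Qed.

(** [Y] is [N] times a contraction for a natural number [N], so repeated addition reduces to that
    case. *)
Lemma trace_finM X Y : A X -> A Y -> trace_fin X -> trace_fin (Y * X).
Proof.
move=> AX AY Xf; have /bounded_opP[_ [c c0 Yc]] := bop_bounded Y.
pose N := (Num.truncn c).+1.
have N0 : (0 : R) < N%:R by rewrite ltr0n.
pose Y0 := bscale L (N%:R^-1)%:C * Y.
have AY0 : A Y0 by apply: (commutantM S0s) => //; exact: commutant_scale.
have Y0c : contraction Y0.
  move=> x; rewrite bopM bscaleE hnormZ cabs_real gtr0_norm ?invr_gt0//.
  rewrite mulrC ler_pdivrMr// mulrC; apply: le_trans (Yc _) _.
  by rewrite ler_wpM2r ?hnorm_ge0// ltW// truncnS_gt.
have natE n (a : bop L) : bscale L n%:R * a = a *+ n.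
  elim: n => [|n IH].
    by apply: bop_ext => x; rewrite bopM bscaleE scale0r.
  rewrite [RHS]mulrS -IH; apply: bop_ext => x.
  by rewrite bopD !bopM !bscaleE -[n.+1%:R]natr1 scalerDl scale1r addrC.
have -> : Y * X = (Y0 * X) *+ N.
  rewrite -natE /Y0 !mulrA bscaleM.
  have -> : N%:R * (N%:R^-1)%:C = 1 :> R[i].
    have -> : (N%:R : R[i]) = (N%:R : R)%:C by rewrite rmorph_nat.
    by rewrite -realCM mulfV// gt_eqF.
  by rewrite bscale1 mul1r.
have AYX : A (Y0 * X) by exact: (commutantM S0s).
have YXf : trace_fin (Y0 * X) by exact: trace_fin_contraction.
suff : A ((Y0 * X) *+ N) /\ trace_fin ((Y0 * X) *+ N) by case.
elim: N {N0 Y0 Y0c AY0} (Y0 * X) AYX YXf => [|n IH] Z AZ Zf.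
  split; first exact: (commutant0 S0s).
  rewrite /trace_fin mulr0n mulr0 /atr /amplified_trace eseries0 ?ltry// =>
    i _ _.
  have -> : adj (t (e i)) \o (0 : bop L) \o t (e i) = 0.
    by apply/funext => k /=;
      rewrite (linear_op0 (bounded_linear
        (bounded_adj (bounded_tensorr tT _)))).
  by rewrite (tau0 Mvn tauP).
have [AIH IHf] := IH _ AZ Zf; rewrite mulrS; split;
  first exact: (commutantD S0s).
exact: trace_finD.
Qed.

Lemma trace_fin_star X : A X -> trace_fin X -> trace_fin (star X).
Proof. by move=> AX;
  rewrite /trace_fin starK (atr_gramC tT Mvn tauP eB eB AX). Qed.

Lemma finite_trace_ideal_fin X : Minf X -> A X /\ trace_fin X.
Proof.
have bA T (AT : A T) := commutant_bounded AT.
suff /(_ X) sub : Minf `<=` [set T : L ->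
  L | exists Y : bop L, [/\ T = bop_fun Y, A Y & trace_fin Y]].
  by move=> /sub [Y [XY AY Yf]]; rewrite (_ : X = Y)//; apply: bop_ext => x;
    rewrite XY.
apply: smallest_sub.
  split=> [_ [Y [-> AY _]]//||_ _ [X1 [-> A1 f1]] [X2 [->
    A2 f2]]|T _ AT [X2 [-> A2 f2]]].
  - exists 0; split=> //; first exact: (commutant0 S0s).
    rewrite /trace_fin mulr0 /atr /amplified_trace eseries0 ?ltry// => i _ _.
    have -> : adj (t (e i)) \o (0 : bop L) \o t (e i) = 0.
      by apply/funext => k /=;
        rewrite (linear_op0 (bounded_linear
          (bounded_adj (bounded_tensorr tT _)))).
    by rewrite (tau0 Mvn tauP).
  - exists (X1 + X2); split=> //; first exact: (commutantD S0s).
    exact: trace_finD.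
  - pose T' := Bop (bA _ AT); have AT' : A T' by [].
    split.
      exists (T' * X2); split=> //; first exact: (commutantM S0s).
      exact: trace_finM.
    exists (X2 * T'); split=> //; first exact: (commutantM S0s).
    (* Right multiplication reduces to left multiplication by taking adjoints. *)
    rewrite -[X2 * T']starK starM; apply: trace_fin_star.
      by apply: (commutantM S0s); exact: (commutant_star S0s).
    apply: trace_finM; [exact: (commutant_star S0s)|exact:
      (commutant_star S0s)|].
    exact: trace_fin_star.
move=> p [Ap [pp pst] [e' e'B pf]].
pose p' := Bop (bA _ Ap); exists p'; split=> //.
have pst' : star p' = p' by apply: bop_ext => x; rewrite /= pst.
have pp' : p' * p' = p' by apply: bop_ext => x; exact: (congr1 (@^~ x) pp).
(* The basis [e'] in which [p] is known to be finite may differ from [e]; the exchange of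
   [star X * X] and [X * star X] also changes the basis. *)
rewrite /trace_fin (atr_gramC tT Mvn tauP eB e'B)// pst' pp'.
exact: pf.
Qed.

End WithBasis.
End FiniteTrace.

(** * Comparison of finite projections *)

Section Comparison.
Context {R : realType} {H K L : hilbertType R}.
Variables (t : H -> K -> L) (M : set (K -> K)) (tau : (K -> K) -> R[i]).
Hypotheses (tT : hilbert_tensor t) (Mf : factor_algebra M).
Hypothesis tauP : faithful_normal_tracial_state M tau.
Variable e : nat -> H.
Hypothesis eB : orthonormal_basis e.

Let Mvn : von_neumann_algebra M := Mf.1.
Let A := amplification t M.
Let S0 := commutant (tensor_generators t M).
Let S0s : star_closed S0 :=
  commutant_star_closed (tensor_generators_star_closed tT Mvn).

Local Notation tfin := (trace_fin t tau e).

(* The projections [star V ^+ n * (P - star V * V) * V ^+ n] are equivalent and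
   their sum is below [P], so they vanish when [P] has finite trace. *)
Lemma wandering_eq0 (P V : bop L) : A P -> A V -> projector P -> tfin P ->
  P * V = V -> V * P = V -> V * star V * V = V ->
  (forall n, (P - V * star V) * star V ^+ n * (P - star V * V) = 0) ->
  P = star V * V.
Proof.
move=> AP AV [PP Pst] Pf PV VP VVV wand.
have AV' : A (star V) by exact: (commutant_star S0s).
have PV' : P * star V = star V by rewrite -{2}VP starM Pst.
have V'P : star V * P = star V by rewrite -{2}PV starM Pst.
set e' := P - star V * V.
have Ae : A e' by apply: (commutantB S0s) => //; exact: (commutantM S0s).
have est : star e' = e' by rewrite starB starM starK Pst.
have Pe : P * e' = e' by rewrite mulrBr PP mulrA PV'.
have ee : e' * e' = e'.
  rewrite {1}/e' mulrBl Pe /e' mulrBr -[star V * V * P]mulrA VP.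
  by rewrite !mulrA -[star V * V * star V * V]mulrA -[star V * V * _]mulrA
    [V * (star V * V)]mulrA VVV subrr subr0.
have PVe n : P * (star V ^+ n * e') = star V ^+ n * e'.
  by case: n => [|n]; [rewrite expr0 mul1r|rewrite exprS !mulrA PV'].
(* The hypothesis keeps the range of [star V ^+ n * e'] inside the final space of [V], so [V ^+ n]
   undoes [star V ^+ n] on [e']. *)
have VVe n : V * star V * (star V ^+ n * e') = star V ^+ n * e'.
  have := wand n; rewrite -mulrA mulrBl PVe => /subr0_eq <-.
  by [].
have VnVn n : V ^+ n * star V ^+ n * e' = e'.
  elim: n => [|n IH]; first by rewrite !expr0 !mul1r.
  by rewrite exprSr exprS -!mulrA [V * (star V * _)]mulrA VVe mulrA.
pose d n := star V ^+ n * P * V ^+ n.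
(* [d] telescopes with increments [g], and each [g n] has the trace of [e']; thus the trace of [P]
   is at least [n] times that of [e']. *)
pose g n := star (e' * V ^+ n) * (e' * V ^+ n).
have dS n : d n = d n.+1 + g n.
  rewrite /g starM starX est !mulrA -[star V ^+ n * e' * e']mulrA ee /d.
  rewrite exprSr exprS !mulrA -[star V ^+ n * star V * P]mulrA V'P.
  rewrite -[star V ^+ n * star V * V]mulrA -mulrDl -mulrDr /e'.
  by rewrite addrC subrK.
have AXn n : A (e' * V ^+ n) by apply: (commutantM S0s) => //;
  exact: (commutantX S0s).
have APn n : A (P * V ^+ n) by apply: (commutantM S0s) => //;
  exact: (commutantX S0s).
have gpos n : trace_pos_op t M tau (g n) := trace_pos_gram tT Mvn tauP (AXn n).
have dE n : d n = star (P * V ^+ n) * (P * V ^+ n).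
  by rewrite starM starX Pst !mulrA -[_ * P * P]mulrA PP.
have dpos n : trace_pos_op t M tau (d n) by rewrite dE;
  exact: (trace_pos_gram tT Mvn tauP (APn n)).
have gE n : atr t tau e (g n) = atr t tau e e'.
  rewrite /g (atr_gramC tT Mvn tauP eB eB (AXn n)) starM starX est.
  by rewrite !mulrA -[e' * V ^+ n * _]mulrA -mulrA VnVn ee.
have epos : trace_pos_op t M tau e' by rewrite -ee -{1}est;
  exact: (trace_pos_gram tT Mvn tauP Ae).
have e0 : (0 <= atr t tau e e')%E by exact: (atr_ge0 e epos).
have dn n : atr t tau e (d n) = (atr t tau e (d n.+1) + atr t tau e e')%E.
  by rewrite dS (atrD tT Mvn tauP)// gE.
have d0 : (atr t tau e (d 0%N) < +oo)%E.
  by rewrite /d !expr0 mul1r mulr1; move: Pf; rewrite /trace_fin Pst PP.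
apply/subr0_eq; rewrite -/e'.
apply: (atr_gram_eq0 tT Mvn tauP eB Ae); rewrite est ee.
move: e0 dn; case: (atr t tau e e') => [r||//] e0 dn; last first.
  by move: d0; rewrite dn addey// gt_eqF//
    (lt_le_trans _ (atr_ge0 e (dpos _)))// ltNy0.
have dr n : atr t tau e (d 0%N) = (atr t tau e (d n) + (n%:R * r)%:E)%E.
  elim: n => [|n IH]; first by rewrite mul0r adde0.
  rewrite IH dn -addeA -EFinD; congr (_ + _%:E)%E.
  by rewrite -natr1 mulrDl mul1r addrC.
have rn n : ((n%:R * r)%:E <= atr t tau e (d 0%N))%E.
  by rewrite (dr n) leeDr// (atr_ge0 e (dpos _)).
move: d0 rn; case: (atr t tau e (d 0%N)) => [c||] //= _ rn;
  last by have := rn 0%N.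
rewrite lee_fin in e0; congr (_%:E); apply/eqP; rewrite eq_le e0 andbT leNgt.
apply/negP => r0; have := rn (Num.truncn (c / r)).+1.
rewrite lee_fin -ler_pdivlMr// => /(lt_le_trans (truncnS_gt _)).
by rewrite ltxx.
Qed.

(** The usual formula for the join: [r] is [q] plus the initial projection of the polar part [W] of
    [p * (1 - q)]. That projection is orthogonal to [q], and it is finite because [W = p * W]. *)
Lemma amplification_range_projection (p q : bop L) : A p -> A q ->
  projector p -> projector q ->
  tfin p -> tfin q -> exists r : bop L,
  [/\ A r, projector r, tfin r, p * r = p & q * r = q].
Proof.
move=> Ap Aq [pp pst] [qq qst] pf qf.
set T := p * (1 - q).
have AT : A T.
  by apply: (commutantM S0s) => //; apply: (commutantB S0s) => //;
    exact: (commutant1 S0s).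
have [Q [QA Qst QQ]] := commutant_modulus S0s AT.
have nQT := hnorm_star_mul _ (etrans (congr1 (fun q => q * Q) Qst) QQ).
pose G := [set x : L * L | exists z, x = (Q z, T z)].
have Gi : isometric_graph G.
  split=> [|a _ _ _ _ [z [-> ->]] [z' [-> ->]]|_ _ [z [-> ->]]].
  - by exists 0; rewrite !bop_x0.
  - by exists (a *: z + z'); rewrite !bop_linear.
  - exact: nQT.
have [W [GW GW' Wlim Wcomm]] := partial_isometry_of_graph Gi.
have comm (s : bop L) : S0 s -> forall x y, G (x, y) -> G (s x, s y).
  move=> Ss _ _ [z [-> ->]]; exists (s z).
  have c (b : bop L) : A b -> s (b z) = b (s z).
    by move=> /(commutantP _ S0s)/(_ _ Ss)/(congr1 (fun q : bop L => q z)).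
  by rewrite (c _ QA) (c _ AT).
have AW : A W.
  apply/(commutantP _ S0s) => s Ss; apply: Wcomm; apply: comm => //.
  exact: star_closed_star.
have AW' : A (star W) by exact: (commutant_star S0s).
have WQ : W * Q = T by apply: bop_ext => z; apply: GW; exists z.
have WWQ : star W * W * Q = Q.
  by rewrite -mulrA WQ; apply: bop_ext => z; apply: GW'; exists z.
have QWW : Q * (star W * W) = Q.
  by have := congr1 (@star _ _) WWQ; rewrite !starM starK Qst.
have TWW : T * (star W * W) = T by rewrite -WQ -mulrA QWW.
have pT : p * T = T by rewrite mulrA pp.
have pW : p * W = W.
  apply: bop_ext => z; rewrite bopM; have [u [v [Guv up vp]]] := Wlim z.
  apply: (hcvg_unique (bounded_cvg (bop_bounded p) vp)).
  suff -> : (fun n => p (v n)) = v by [].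
  apply/funext => n; have [z' [_ ->]] := Guv n.
  exact: (congr1 (fun q : bop L => q z') pT).
have Tq : T * q = 0 by rewrite -mulrA mulrBl mul1r qq subrr mulr0.
have Qq : Q * q = 0.
  by apply: bop_ext => z; apply: hnorm_eq0; rewrite bopM nQT -bopM Tq hnorm0.
have qQ : q * Q = 0 by have := congr1 (@star _ _) Qq;
  rewrite starM star0 Qst qst.
have qWW : q * (star W * W) = 0.
  apply: bop_ext => z; rewrite bopM; have [u [v [Guv up vp]]] := Wlim z.
  apply: (hcvg_unique (bounded_cvg (bop_bounded q) up)).
  have -> : (fun n => q (u n)) = fun=> 0.
    apply/funext => n; have [z' [-> _]] := Guv n.
    exact: (congr1 (fun q : bop L => q z') qQ).
  exact: hcvg_cst.
have WWq : star W * W * q = 0.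
  by have := congr1 (@star _ _) qWW; rewrite !starM starK star0 qst.
have WWW : star W * W * (star W * W) = star W * W.
  apply: bop_ext => z; rewrite bopM; have [u [v [Guv up vp]]] := Wlim z.
  apply: (hcvg_unique (bounded_cvg (bop_bounded (star W * W)) up)).
  have -> : (fun n => (star W * W) (u n)) = u; last exact: up.
  apply/funext => n; have [z' [-> _]] := Guv n.
  exact: (congr1 (fun q : bop L => q z') WWQ).
have Wf : tfin W.
  rewrite -pW -[p * W]starK starM pst.
  apply: (trace_fin_star tT Mvn tauP eB); first exact: (commutantM S0s).
  exact: (trace_finM tT Mvn tauP).
exists (q + star W * W); split.
- by apply: (commutantD S0s) => //; exact: (commutantM S0s).
- split; last by rewrite starD starM starK qst.
  by rewrite mulrDl !mulrDr qq qWW WWq WWW addr0 add0r.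
- apply: (trace_finD tT Mvn tauP) => //; first exact: (commutantM S0s).
  exact: (trace_finM tT Mvn tauP).
(* As [q] kills [star W * W], the identity [TWW] reads [p * (star W * W) = p * (1 - q)]. *)
- have := TWW; rewrite /T -!mulrA [(1 - q) * (_ * _)]mulrBl qWW mul1r subr0 =>
    E.
  by rewrite mulrDr E mulrBr mulr1 addrC subrK.
- by rewrite mulrDr qq qWW addr0.
Qed.

Lemma orthogonal_conjugate (p q : bop L) : A p -> A q ->
  projector p -> projector q -> tfin p -> tfin q ->
  exists u : bop L, [/\ A u, star u * u = 1, u * star u = 1
    & u * p * star u * q = 0].
Proof.
move=> Ap Aq pp qp pf qf.
have [r [Ar [rr rst] rf pr qr]] :=
  amplification_range_projection Ap Aq pp qp pf qf.
have [[ppp pst] [qq qst]] := (pp, qp).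
have A1 : A (1 : bop L) := commutant1 S0s.
have gp : projector (1 - r).
  by split; rewrite ?starB ?star1 ?rst// mulrBl mul1r mulrBr mulr1 rr subrr
    subr0.
have Ag : A (1 - r) by exact: (commutantB S0s).
have [w [Aw gw wp www wmax]] := max_partial_isometry S0s pp gp Ap Ag.
have Aw' : A (star w) by exact: (commutant_star S0s).
have wf : tfin w by rewrite -wp; exact: (trace_finM tT Mvn tauP).
have ww : star w * w = p.
  (* Factoriality: either [1 - r] or [p] is exhausted by [w]. In the first case [1 - r = w * star w]
     would be finite, and so would [1]. *)
  have [] := amplification_orthogonal tT Mf _ _ wmax.
  - by apply: (commutantB S0s) => //; exact: (commutantM S0s).
  - by apply: (commutantB S0s) => //; exact: (commutantM S0s).
  - move=> /subr0_eq gE; exfalso.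
    have : tfin ((1 - r) + r).
      apply: (trace_finD tT Mvn tauP) => //; rewrite gE.
      apply: (trace_finM tT Mvn tauP) => //.
      exact: (trace_fin_star tT Mvn tauP eB).
    by rewrite subrK /trace_fin star1 mulr1 (atr1 tT tauP eB) ltxx.
  - by move=> /subr0_eq.
have pw : p * w = 0 by rewrite -gw mulrA mulrBr mulr1 pr subrr mul0r.
have qw : q * w = 0 by rewrite -gw mulrA mulrBr mulr1 qr subrr mul0r.
have w'p : star w * p = 0.
  by have := congr1 (@star _ _) pw; rewrite starM pst star0.
have w'q : star w * q = 0.
  by have := congr1 (@star _ _) qw; rewrite starM qst star0.
have pw' : p * star w = star w.
  by have := congr1 (@star _ _) wp; rewrite starM pst.
have ww0 : w * w = 0 by rewrite -{1}wp -mulrA pw mulr0.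
have w'w'0 : star w * star w = 0 by rewrite -starM ww0 star0.
set c := 1 - p - w * star w.
have cst : star c = c by rewrite !starB star1 pst starM starK.
have wc : w * c = 0.
  by rewrite /c !mulrBr mulr1 wp subrr mulrA ww0 mul0r subr0.
have cw : c * w = 0.
  by rewrite /c !mulrBl mul1r pw www subr0 subrr.
have w'c : star w * c = 0.
  by have := congr1 (@star _ _) cw; rewrite starM cst star0.
have cw' : c * star w = 0.
  by have := congr1 (@star _ _) wc; rewrite starM cst star0.
have cp : c * p = 0.
  by rewrite /c !mulrBl mul1r ppp subrr -mulrA w'p mulr0 subr0.
have cc : c * c = c.
  by rewrite {2}/c !mulrBr mulr1 cp subr0 mulrA cw mul0r subr0.
have cE : c + p + w * star w = 1 by rewrite /c addrAC subrK subrK.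
have Ac : A c.
  by apply: (commutantB S0s); [exact: (commutantB S0s)|exact: (commutantM S0s)].
clearbody c.
(* The symmetry exchanging [p] and [w * star w] and fixing their common complement [c]. *)
pose u := w + star w + c.
have ust : star u = u by rewrite /u starD cst starD starK [star w + w]addrC.
have uu : u * u = 1.
  rewrite /u !mulrDl !mulrDr ww0 w'w'0 ww wc w'c cw cw' cc.
  by rewrite !addr0 !add0r addrAC -cE -addrA addrC.
have up : u * p = w.
  by rewrite /u !mulrDl wp w'p cp !addr0.
exists u; rewrite ust; split=> //.
- by apply: (commutantD S0s) => //; exact: (commutantD S0s).
- rewrite up /u !mulrDr ww0 wc add0r addr0.
  by rewrite -mulrA w'q mulr0.
Qed.

End Comparison.

(** * Cancellation *)

Section Cancellation.
Context {R : realType} {G H K L : hilbertType R}.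
Variables (N : set (G -> G)).
Variables (t : H -> K -> L) (M : set (K -> K)) (tau : (K -> K) -> R[i]).
Hypotheses (tT : hilbert_tensor t) (Mf : factor_algebra M).
Hypothesis tauP : faithful_normal_tracial_state M tau.
Hypothesis Nvn : von_neumann_algebra N.

Let Mvn : von_neumann_algebra M := Mf.1.
Let Ns := vn_star_closed Nvn.
Let A := amplification t M.
Let S0 := commutant (tensor_generators t M).
Let S0s : star_closed S0 :=
  commutant_star_closed (tensor_generators_star_closed tT Mvn).

Lemma vn_id : N id.
Proof. by rewrite (vnE Nvn);
  exact: (commutant1 (commutant_star_closed Ns)). Qed.

Lemma adj_id : adj (@id G) = id.
Proof. exact: adj_eq. Qed.

Record bop_hom (r : (G -> G) -> bop L) : Prop := {
  bop_hom_in : forall x, N x -> A (r x);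
  bop_hom_mul : forall x y, N x -> N y -> r (x \o y) = r x * r y;
  bop_hom_star : forall x, N x -> r (adj x) = star (r x)
}.

Lemma bop_hom_projector r : bop_hom r -> projector (r id).
Proof.
move=> rH; split.
  by rewrite -(bop_hom_mul rH vn_id vn_id).
by rewrite -(bop_hom_star rH vn_id) adj_id.
Qed.

Lemma bop_hom_mul1 r x : bop_hom r -> N x -> r id * r x = r x.
Proof. by move=> rH Nx; rewrite -(bop_hom_mul rH vn_id Nx). Qed.

Lemma bop_hom_1mul r x : bop_hom r -> N x -> r x * r id = r x.
Proof. by move=> rH Nx; rewrite -(bop_hom_mul rH Nx vn_id). Qed.

Section Orthogonal.
Variables r f : (G -> G) -> bop L.
Hypotheses (rH : bop_hom r) (fH : bop_hom f) (rf : r id * f id = 0).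

Lemma orthogonal_sym : f id * r id = 0.
Proof.
have [_ rst] := bop_hom_projector rH; have [_ fst] := bop_hom_projector fH.
by rewrite -rst -fst -starM rf star0.
Qed.

Lemma orthogonal_mul x y : N x -> N y -> r x * f y = 0.
Proof.
move=> Nx Ny; rewrite -(bop_hom_1mul rH Nx) -(bop_hom_mul1 fH Ny).
by rewrite mulrA -[r x * _ * _]mulrA rf mulr0 mul0r.
Qed.

Lemma orthogonal_mul' x y : N x -> N y -> f x * r y = 0.
Proof.
move=> Nx Ny; rewrite -(bop_hom_1mul fH Nx) -(bop_hom_mul1 rH Ny).
by rewrite mulrA -[f x * _ * _]mulrA orthogonal_sym mulr0 mul0r.
Qed.

End Orthogonal.

Section Core.
Variable e : nat -> H.
Hypothesis eB : orthonormal_basis e.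
Variables (r1 f1 r2 f2 : (G -> G) -> bop L) (w : bop L).
Hypotheses (r1H : bop_hom r1) (f1H : bop_hom f1).
Hypotheses (r2H : bop_hom r2) (f2H : bop_hom f2).
Hypothesis rfE : forall x, N x -> r1 x + f1 x = r2 x + f2 x.
Hypotheses (Aw : A w) (ww : star w * w = 1).
Hypothesis r2E : forall x, N x -> r2 x = w * r1 x * star w.

Lemma cancellation_core : r1 id * f1 id = 0 -> r2 id * f2 id = 0 ->
  trace_fin t tau e (r1 id + f1 id) -> exists u : bop L,
  [/\ A u, star u * u = 1, u * star u = 1
    & forall x, N x -> f2 x = u * f1 x * star u].
Proof.
move=> rf1 rf2 finP; pose pi x := r1 x + f1 x.
have [pp pst] := bop_hom_projector r1H; have [qq qst] := bop_hom_projector r2H.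
have [aa ast] := bop_hom_projector f1H; have [bb bst] := bop_hom_projector f2H.
have N1 := vn_id.
set p := r1 id in pp pst rf1 finP *; set a := f1 id in aa ast rf1 finP *.
set q := r2 id in qq qst rf2 *; set b := f2 id in bb bst rf2 *.
have ap : a * p = 0 by exact: (orthogonal_sym r1H f1H rf1).
have bq : b * q = 0 by exact: (orthogonal_sym r2H f2H rf2).
pose P := p + a.
have PE : P = q + b by exact: (rfE N1).
have AP : A P by apply: (commutantD S0s); exact: (bop_hom_in _ N1).
have Pst : star P = P by rewrite starD pst ast.
have PP : P * P = P by rewrite mulrDl !mulrDr pp rf1 ap aa addr0 add0r.
have Pq : P * q = q by rewrite PE mulrDl qq bq addr0.
have Pa : P * a = a by rewrite mulrDl rf1 aa add0r.
have Pb : P * b = b by rewrite PE mulrDl rf2 bb add0r.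
have qP : q * P = q by rewrite PE mulrDr qq rf2 addr0.
have pP : p * P = p by rewrite mulrDr pp rf1 addr0.
have aP : a * P = a by rewrite mulrDr ap aa add0r.
have bP : b * P = b by rewrite PE mulrDr bq bb add0r.
have pi2 x : N x -> pi x = r2 x + f2 x by exact: rfE.
have api x : N x -> a * pi x = f1 x.
  move=> Nx; rewrite mulrDr (orthogonal_mul' r1H f1H rf1)// add0r.
  exact: bop_hom_mul1.
have pia x : N x -> pi x * a = f1 x.
  move=> Nx; rewrite mulrDl (orthogonal_mul r1H f1H rf1)// add0r.
  exact: bop_hom_1mul.
have bpi x : N x -> b * pi x = f2 x.
  move=> Nx; rewrite pi2// mulrDr (orthogonal_mul' r2H f2H rf2)// add0r.
  exact: bop_hom_mul1.
have pib x : N x -> pi x * b = f2 x.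
  move=> Nx; rewrite pi2// mulrDl (orthogonal_mul r2H f2H rf2)// add0r.
  exact: bop_hom_1mul.
have ppi x : N x -> p * pi x = r1 x.
  move=> Nx; rewrite mulrDr (orthogonal_mul r1H f1H rf1)// addr0.
  exact: bop_hom_mul1.
have piq x : N x -> pi x * q = r2 x.
  move=> Nx; rewrite pi2// mulrDl (orthogonal_mul' r2H f2H rf2)// addr0.
  exact: bop_hom_1mul.
(* The commutant of [S] is the relative commutant of [pi(N)] in the amplification. *)
pose S := S0 `|` [set T : L -> L | exists2 x, N x & T = pi x].
have Ss : star_closed S.
  split=> [T [/S0s.1//|[x Nx ->]]|T [/S0s.2|[x Nx ->]]];
    first exact: bop_bounded.
    by left.
  right; exists (adj x); first exact: Ns.2.
  by rewrite /pi !bop_hom_star// -starD.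
have SP (c : bop L) : A c -> (forall x, N x -> pi x * c = c * pi x) ->
  commutant S c.
  move=> /(commutantP _ S0s) Ac pc;
    apply/(commutantP _ Ss) => s [/Ac//|[x Nx sE]].
  by have -> : s = pi x; [apply: bop_ext => v; rewrite sE|exact: pc].
have SA (c : bop L) : commutant S c -> A c.
  move=> /(commutantP _ Ss) Sc; apply/(commutantP _ S0s) => s Ss0.
  by apply: Sc; left.
have Spi (c : bop L) x : commutant S c -> N x -> pi x * c = c * pi x.
  by move=> /(commutantP _ Ss) Sc Nx; apply: Sc; right; exists x.
have qE : q = w * p * star w by exact: r2E.
have qw : q * w = w * p by rewrite qE -mulrA ww mulr1.
pose v := w * p.
(* Both [v * pi x] and [pi x * v] equal [w * r1 x], because [p] and [q] cut [pi] down to [r1] and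
   [r2]. *)
have Sv : commutant S v.
  apply: SP => [|x Nx].
    by apply: (commutantM S0s) => //; exact: (bop_hom_in r1H N1).
  rewrite /v -mulrA ppi// -qw mulrA piq// r2E// -!mulrA ww mulr1.
  by [].
have Sa : commutant S a.
  by apply: SP => [|x Nx]; [exact: (bop_hom_in f1H N1)|rewrite api// pia].
have Sb : commutant S b.
  by apply: SP => [|x Nx]; [exact: (bop_hom_in f2H N1)|rewrite bpi// pib].
have [w' [Sw' bw' w'a www wmax]] :=
  max_partial_isometry Ss (conj aa ast) (conj bb bst) Sa Sb.
have aw' : a * star w' = star w' by have := congr1 (@star _ _) w'a;
  rewrite starM ast.
have w'b : star w' * b = star w' by have := congr1 (@star _ _) bw';
  rewrite starM bst.
have vp : v * p = v by rewrite /v -mulrA pp.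
have qv : q * v = v by rewrite /v mulrA qw -mulrA pp.
have va : v * a = 0 by rewrite -vp -mulrA rf1 mulr0.
have bv : b * v = 0 by rewrite -qv mulrA bq mul0r.
have qw' : q * w' = 0 by rewrite -bw' mulrA rf2 mul0r.
have w'q : star w' * q = 0 by rewrite -w'b -mulrA bq mulr0.
have w'p : w' * p = 0 by rewrite -w'a -mulrA ap mulr0.
have v'v : star v * v = p
  by rewrite /v starM pst -!mulrA [star w * _]mulrA ww mul1r pp.
have vv' : v * star v = q
  by rewrite /v starM pst mulrA -[w * p * p]mulrA pp -qE.
pose V := v + w'.
have SV : commutant S V by exact: (commutantD Ss).
have AV : A V by exact: SA.
have v'w' : star v * w' = 0
  by rewrite -bw' -{1}qv starM qst !mulrA -[_ * q * b]mulrA rf2 mulr0 mul0r.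
have w'v : star w' * v = 0 by rewrite -qv mulrA w'q mul0r.
have VsV : star V * V = p + star w' * w'.
  by rewrite starD mulrDl !mulrDr v'v v'w' w'v addr0 add0r.
have vw' : v * star w' = 0 by rewrite -aw' mulrA va mul0r.
have w'v' : w' * star v = 0 by rewrite -[w']starK -starM vw' star0.
have VVs : V * star V = q + w' * star w'.
  by rewrite starD mulrDl !mulrDr vv' vw' w'v' addr0 add0r.
have PV : P * V = V.
  by rewrite /V mulrDr -qv mulrA Pq -bw' mulrA Pb.
have VP : V * P = V.
  by rewrite /V mulrDl -vp -mulrA pP -w'a -mulrA aP.
have VVV : V * star V * V = V.
  rewrite VVs mulrDl /V !mulrDr qv qw' addr0 -[w' * _ * v]mulrA w'v mulr0 add0r.
  by rewrite www.
have e'E : P - star V * V = a - star w' * w'.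
  by rewrite VsV /P opprD addrACA subrr add0r.
have f'E : P - V * star V = b - w' * star w'.
  by rewrite VVs PE opprD addrACA subrr add0r.
have SV' : commutant S (star V) by exact: (commutant_star Ss).
have AV' : A (star V) by exact: SA.
have wand n : (P - V * star V) * star V ^+ n * (P - star V * V) = 0.
  by rewrite e'E f'E; apply: wmax; exact: (commutantX Ss).
(* The defects of [V] are the leftovers of [w'], and powers of [star V] lie in the relative
   commutant, so maximality of [w'] is exactly the condition [wand]. *)
have PVsV : P = star V * V.
  exact: (wandering_eq0 tT Mf tauP eB AP AV (conj PP Pst) finP PV VP VVV wand).
have PVVs : P = V * star V.
  (* The conditions are symmetric under adjoints, so the same argument applied to [star V] removes
     the other defect. *)
  have := @wandering_eq0 _ _ _ _ _ _ _ tT Mf tauP e eB P (star V) AP AV'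
    (conj PP Pst) finP.
  rewrite starK; apply.
  - by have := congr1 (@star _ _) VP; rewrite starM Pst.
  - by have := congr1 (@star _ _) PV; rewrite starM Pst.
  - by have := congr1 (@star _ _) VVV; rewrite !starM starK mulrA.
  - move=> n; have := congr1 (@star _ _) (wand n).
    by rewrite !starM !starB !starM !starK Pst starX starK star0 mulrA.
have V'P : star V * P = star V by have := congr1 (@star _ _) PV;
  rewrite starM Pst.
have PV' : P * star V = star V by have := congr1 (@star _ _) VP;
  rewrite starM Pst.
have piP x : N x -> pi x * P = pi x.
  move=> Nx; rewrite /P mulrDr pia//; congr (_ + _).
  by rewrite mulrDl (orthogonal_mul' r1H f1H rf1)// addr0; exact: bop_hom_1mul.
have Ppi x : N x -> P * pi x = pi x.
  by move=> Nx; rewrite /P mulrDl api// ppi.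
pose c := 1 - P.
have Pc : P + c = 1 by rewrite addrC subrK.
have Ac : A c by apply: (commutantB S0s) => //; exact: (commutant1 S0s).
have cst : star c = c by rewrite starB star1 Pst.
have cl (T : bop L) : P * T = T -> c * T = 0.
  by move=> PT; rewrite mulrBl mul1r PT subrr.
have cr (T : bop L) : T * P = T -> T * c = 0.
  by move=> TP; rewrite mulrBr mulr1 TP subrr.
have cc : c * c = c by rewrite {2}/c mulrBr mulr1 cl ?subr0.
have Va : V * a = w' by rewrite /V mulrDl va add0r w'a.
have bV : b * V = w' by rewrite /V mulrDr bv add0r bw'.
clearbody c V P pi.
(* [V] is now unitary on the range of [P]. The unitary [U] commutes with [pi] and satisfies
   [U * a = b * U], so it carries [f1 = a * pi] to [f2 = b * pi]. *)
pose U := V + c.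
have Ust : star U = star V + c by rewrite starD cst.
have U'U : star U * U = 1.
  by rewrite Ust /U mulrDl !mulrDr cc -PVsV cr// cl// addr0 add0r.
have UU' : U * star U = 1.
  by rewrite Ust /U mulrDl !mulrDr cc -PVVs cr// cl// addr0 add0r.
have Ua : U * a = b * U.
  by rewrite /U mulrDl mulrDr (cl a)// (cr b)// !addr0 Va bV.
have Upi x : N x -> U * pi x = pi x * U.
  move=> Nx; rewrite /U mulrDl mulrDr (Spi _ _ SV Nx).
  by rewrite (cl _ (Ppi _ Nx)) (cr _ (piP _ Nx)).
exists U; split=> //; first exact: (commutantD S0s).
move=> x Nx; rewrite -api// mulrA Ua -[b * U * _]mulrA Upi// -!mulrA UU' mulr1.
by rewrite bpi.
Qed.

End Core.

End Cancellation.

(** * Homomorphisms up to unitary conjugation *)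

Section HomClasses.
Context {R : realType} {G L : hilbertType R}.
Variables (N : set (G -> G)) (S : set (L -> L)) (I : set (L -> L)).
Hypotheses (Ss : star_closed S).

Let A := commutant S.

Hypothesis AI : two_sided_ideal A I.
Hypothesis Nvn : von_neumann_algebra N.
Implicit Types (pi : (G -> G) -> (L -> L)) (u w : bop L).

(** Homomorphisms are plain functions, unconstrained outside [N]; the default [0] makes the passage
    to [bop] total. *)
Definition lift_op (T : L -> L) : bop L :=
  if pselect (bounded_op T) is left Tb then Bop Tb else 0.

Lemma lift_opE (T : L -> L) : bounded_op T -> lift_op T = T :> (L -> L).
Proof. by rewrite /lift_op; case: pselect. Qed.

Definition unitary u : Prop := [/\ A u, star u * u = 1 & u * star u = 1].

Definition conj_hom u pi : (G -> G) -> (L -> L) :=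
  fun x => u \o pi x \o star u.

Lemma unitaryK u v : unitary u -> star u (u v) = v.
Proof. by move=> [_ uu _]; exact: (congr1 (fun q : bop L => q v) uu). Qed.

Lemma unitary_star u : unitary u -> unitary (star u).
Proof. by move=> [Au uu uu']; split; rewrite ?starK//;
  exact: (commutant_star Ss). Qed.

Lemma unitaryM u w : unitary u -> unitary w -> unitary (u * w).
Proof.
move=> [Au uu uu'] [Aw ww ww']; split; first exact: (commutantM Ss).
  by rewrite starM mulrA -[star w * _ * u]mulrA uu mulr1.
by rewrite starM mulrA -[u * w * _]mulrA ww' mulr1.
Qed.

Lemma conj_equivP pi1 pi2 : conj_equiv N A pi1 pi2 <->
  exists2 u, unitary u & forall x, N x -> pi1 x = conj_hom u pi2 x.
Proof.
split=> [[u [Au [uu uu'] uE]]|[u [Au uu uu'] uE]].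
  exists (Bop (commutant_bounded Au)); last exact: uE.
  by split=> //; apply: bop_ext => v;
    [exact: (congr1 (@^~ v) uu')|exact: (congr1 (@^~ v) uu)].
exists u; split=> //; split.
  by have := congr1 (@bop_fun _ _) uu'.
by have := congr1 (@bop_fun _ _) uu.
Qed.

Lemma conj_equiv_refl pi : conj_equiv N A pi pi.
Proof.
apply/conj_equivP; exists 1 => [|x _]; last by rewrite /conj_hom star1.
by split; rewrite ?star1 ?mulr1//; exact: (commutant1 Ss).
Qed.

Lemma conj_equiv_sym pi1 pi2 : conj_equiv N A pi1 pi2 -> conj_equiv N A pi2 pi1.
Proof.
move=> /conj_equivP[u uU uE]; apply/conj_equivP.
exists (star u); first exact: unitary_star.
move=> x Nx; apply/funext => v.
rewrite /conj_hom (uE _ Nx) starK.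
by rewrite -[RHS]/(star u (u (pi2 x (star u (u v))))) !(unitaryK _ uU).
Qed.

Lemma conj_equiv_trans pi2 pi1 pi3 :
  conj_equiv N A pi1 pi2 -> conj_equiv N A pi2 pi3 -> conj_equiv N A pi1 pi3.
Proof.
move=> /conj_equivP[u uU uE] /conj_equivP[w wU wE]; apply/conj_equivP.
exists (u * w); first exact: unitaryM.
by move=> x Nx; rewrite (uE _ Nx) /conj_hom (wE _ Nx) starM.
Qed.

Lemma eq_hom_class pi1 pi2 : conj_equiv N A pi1 pi2 ->
  hom_class N A I pi1 = hom_class N A I pi2.
Proof.
move=> E; apply/seteqP; split=> pi [pH pE]; split=> //.
  exact: conj_equiv_trans pE E.
by apply: conj_equiv_trans pE _; exact: conj_equiv_sym.
Qed.

Lemma conj_hom_equiv u pi : unitary u -> conj_equiv N A (conj_hom u pi) pi.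
Proof. by move=> uU; apply/conj_equivP; exists u. Qed.

Let Ns := vn_star_closed Nvn.

Section StarHom.
Variable pi : (G -> G) -> (L -> L).
Hypothesis piH : star_hom N I pi.

Lemma star_hom_A x : N x -> A (pi x).
Proof. by case: AI => IA _ _ _ Nx; apply/IA/(star_hom_in piH). Qed.

Lemma star_hom_bounded x : N x -> bounded_op (pi x).
Proof. by move=> Nx; exact: (commutant_bounded (star_hom_A Nx)). Qed.

Lemma lift_homE x : N x -> lift_op (pi x) = pi x :> (L -> L).
Proof. by move=> Nx; rewrite lift_opE//; exact: star_hom_bounded. Qed.

Lemma lift_hom_mul x y : N x -> N y ->
  lift_op (pi (x \o y)) = lift_op (pi x) * lift_op (pi y).
Proof.
move=> Nx Ny; apply: bop_ext => v.
by rewrite bopM !lift_homE//; [rewrite (star_hom_mul piH)|exact: vn_comp].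
Qed.

Lemma lift_hom_star x : N x -> lift_op (pi (adj x)) = star (lift_op (pi x)).
Proof.
move=> Nx; apply: bop_ext => v; rewrite /= !lift_homE//; last exact: Ns.2.
by rewrite (star_hom_adj piH).
Qed.

Lemma star_hom_conj u : unitary u -> star_hom N I (conj_hom u pi).
Proof.
move=> uU; have [Au uu uu'] := uU; have Au' := commutant_star Ss Au.
have [_ _ _ IM] := AI; split.
- move=> x Nx; have [_] := IM _ _ Au' (star_hom_in piH Nx).
  by move=> /(IM _ _ Au)[].
- move=> a x y Nx Ny; rewrite /conj_hom (star_hom_linear piH)//.
  by apply/funext => v;
    rewrite -[LHS]/(u (a *: pi x (star u v) + pi y (star u v))) bop_linear.
- move=> x y Nx Ny; rewrite /conj_hom (star_hom_mul piH)//.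
  apply/funext => v.
  by rewrite -[RHS]/(u (pi x (star u (u (pi y (star u v)))))) (unitaryK _ uU).
- move=> x Nx; rewrite /conj_hom (star_hom_adj piH)//.
  have pb := star_hom_bounded Nx; have ub := bop_bounded u.
  rewrite (adj_comp (bounded_comp ub pb) (bop_bounded (star u))).
  by rewrite (adj_comp ub pb) (adjK ub).
Qed.

End StarHom.

End HomClasses.

Section HomAddition.
Context {R : realType} {G H K L : hilbertType R}.
Variables (N : set (G -> G)).
Variables (t : H -> K -> L) (M : set (K -> K)) (tau : (K -> K) -> R[i]).
Hypotheses (tT : hilbert_tensor t) (Mf : factor_algebra M).
Hypothesis tauP : faithful_normal_tracial_state M tau.
Hypothesis Nvn : von_neumann_algebra N.

Let Mvn : von_neumann_algebra M := Mf.1.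
Let Ns := vn_star_closed Nvn.
Let A := amplification t M.
Let Minf := finite_trace_ideal t M tau.
Let S0 := commutant (tensor_generators t M).
Let S0s : star_closed S0 :=
  commutant_star_closed (tensor_generators_star_closed tT Mvn).
Let AI : two_sided_ideal A Minf := finite_trace_ideal_ideal tau tT Mvn.
Implicit Types pi : (G -> G) -> (L -> L).

Let lift pi x : bop L := lift_op (pi x).

Lemma lift_bop_hom pi : star_hom N Minf pi -> bop_hom N t M (lift pi).
Proof.
move=> piH; split.
- by move=> x Nx; rewrite /lift (lift_homE AI piH Nx);
    exact: (star_hom_A AI piH).
- by move=> x y Nx Ny; exact: (lift_hom_mul AI Nvn piH).
- by move=> x Nx; exact: (lift_hom_star AI Nvn piH).
Qed.

Lemma lift_orthogonal pi1 pi2 : star_hom N Minf pi1 -> star_hom N Minf pi2 ->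
  pi1 id \o pi2 id = 0 -> lift pi1 id * lift pi2 id = 0.
Proof.
move=> pi1H pi2H o; have N1 := vn_id Nvn; apply: bop_ext => v.
by rewrite bopM /lift (lift_homE AI pi1H N1) (lift_homE AI pi2H N1);
  exact: (congr1 (@^~ v) o).
Qed.

(** Orthogonality of the units kills the mixed products. *)
Lemma star_hom_add pi1 pi2 : star_hom N Minf pi1 -> star_hom N Minf pi2 ->
  pi1 id \o pi2 id = 0 -> star_hom N Minf (pi1 + pi2).
Proof.
move=> pi1H pi2H o; have oL := lift_orthogonal pi1H pi2H o.
have [b1 b2] := (lift_bop_hom pi1H, lift_bop_hom pi2H).
have E1 x : N x -> lift pi1 x = pi1 x :> (L -> L) by exact: (lift_homE AI pi1H).
have E2 x : N x -> lift pi2 x = pi2 x :> (L -> L) by exact: (lift_homE AI pi2H).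
have E x : N x -> (pi1 + pi2) x = lift pi1 x + lift pi2 x :> (L -> L).
  by move=> Nx; rewrite -[LHS]/(pi1 x + pi2 x) -E1// -E2.
split.
- move=> x Nx; have [_ _ ID _] := AI.
  by apply: ID; [exact: (star_hom_in pi1H Nx)|exact: (star_hom_in pi2H Nx)].
- move=> a x y Nx Ny; rewrite -[LHS]/(pi1 (a *: x + y) + pi2 (a *: x + y)).
  rewrite (star_hom_linear pi1H)// (star_hom_linear pi2H)//.
  rewrite -[(pi1 + pi2) x]/(pi1 x + pi2 x) -[(pi1 + pi2) y]/(pi1 y + pi2 y).
  by rewrite scalerDr addrACA.
- move=> x y Nx Ny; have Nxy : N (x \o y) by exact: vn_comp.
  rewrite !E// (bop_hom_mul b1)// (bop_hom_mul b2)//.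
  rewrite -[RHS]/(bop_fun
    ((lift pi1 x + lift pi2 x) * (lift pi1 y + lift pi2 y))).
  congr bop_fun.
  rewrite mulrDl !mulrDr (orthogonal_mul Nvn b1 b2 oL)//.
  by rewrite (orthogonal_mul' Nvn b1 b2 oL)// addr0 add0r.
- move=> x Nx; have N'x : N (adj x) by exact: Ns.2.
  rewrite !E// (bop_hom_star b1)// (bop_hom_star b2)// -starD.
  by [].
Qed.

Lemma hom_space_cancel rho phi psi :
  hom_space N A Minf rho -> hom_space N A Minf phi -> hom_space N A Minf psi ->
  hom_add N A Minf rho phi = hom_add N A Minf rho psi -> phi = psi.
Proof.
move=> [r0 r0H <-] [f0 f0H <-] [g0 g0H <-] addE.
have N1 := vn_id Nvn.
apply: (eq_hom_class Minf S0s).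
(* Without a basis the ideal is zero, and both homomorphisms vanish on [N]. *)
have [[e eB]|ne] := pselect (exists e : nat -> H, orthonormal_basis e);
  last first.
  have zero T : Minf T -> T = 0.
    by apply: (finite_trace_ideal_no_basis tT Mvn) => e eB; apply: ne; exists e.
  have [u [Au uu uE]] := conj_equiv_refl N S0s f0.
  exists u; split=> // x Nx.
  by rewrite (zero _ (star_hom_in g0H Nx)) -(zero _ (star_hom_in f0H Nx));
    exact: uE.
have fin pi : star_hom N Minf pi -> trace_fin t tau e (lift pi id).
  move=> piH; have := star_hom_in piH N1.
  rewrite -(lift_homE AI piH N1).
  by move=> /(finite_trace_ideal_fin tT Mvn tauP eB) [].
have inA pi : star_hom N Minf pi -> A (lift pi id).
  by move=> /lift_bop_hom/bop_hom_in; apply.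
have proj pi : star_hom N Minf pi -> projector (lift pi id).
  by move=> /lift_bop_hom/(bop_hom_projector Nvn).
have [u0 [Au0 uu0 uu0' u0o]] := orthogonal_conjugate tT Mf tauP eB
  (inA _ r0H) (inA _ f0H) (proj _ r0H) (proj _ f0H) (fin _ r0H) (fin _ f0H).
have u0U : unitary S0 u0 by [].
have liftE pi x : star_hom N Minf pi -> N x -> lift pi x = pi x :> (L -> L).
  by move=> piH Nx; exact: (lift_homE AI piH Nx).
pose r1 := conj_hom u0 r0.
have r1H : star_hom N Minf r1 by exact: (star_hom_conj S0s AI).
have o1 : r1 id \o f0 id = 0.
  rewrite -(liftE _ _ f0H N1) /r1 /conj_hom -(liftE _ _ r0H N1).
  exact: (congr1 (@bop_fun _ _) u0o).
(* An explicit member of the first sum; the assumed equality places it in the second one, which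
   yields [r2], [g2] and a conjugating [u]. *)
have : hom_add N A Minf (hom_class N A Minf r0) (hom_class N A Minf f0)
  (r1 + f0).
  exists r1, f0; split=> //.
  - by split=> //; exact: (conj_hom_equiv N r0 u0U).
  - by split=> //; exact: (conj_equiv_refl N S0s).
  - by split; [exact: star_hom_add|exact: (conj_equiv_refl N S0s)].
rewrite addE => -[r2 [g2 [[r2H r2E] [g2H g2E] o2 [_ /conj_equivP [u uU uE]]]]].
(* Absorbing [u] turns the equivalence of the two sums into the equality [r1 + f0 = r3 + g3] on
   [N]. *)
pose r3 := conj_hom u r2; pose g3 := conj_hom u g2.
have r3H : star_hom N Minf r3 by exact: (star_hom_conj S0s AI).
have g3H : star_hom N Minf g3 by exact: (star_hom_conj S0s AI).
have o3 : r3 id \o g3 id = 0.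
  apply/funext => v.
  rewrite -[LHS]/(u (r2 id (star u (u (g2 id (star u v)))))) (unitaryK _ uU).
  by rewrite -[r2 id _]/((r2 id \o g2 id) (star u v)) o2 bop_x0.
have rfE x : N x -> lift r1 x + lift f0 x = lift r3 x + lift g3 x.
  move=> Nx; apply: bop_ext => v; rewrite !bopD !liftE//.
  rewrite -[LHS]/((r1 + f0) x v) uE//.
  by rewrite -[LHS]/(u (r2 x (star u v) + g2 x (star u v))) bop_xD.
(* Both represent the class of [r0]: the chain is [r3], [r2], [r0], [r1]. *)
have /conj_equivP[w wU wE] : conj_equiv N A r3 r1.
  apply: (conj_equiv_trans S0s (conj_hom_equiv N r2 uU)).
  apply: (conj_equiv_trans S0s r2E).
  by apply: (conj_equiv_sym S0s); exact: (conj_hom_equiv N r0 u0U).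
have [Aw ww _] := wU.
have r3E x : N x -> lift r3 x = w * lift r1 x * star w.
  move=> Nx; apply: bop_ext => v; rewrite liftE// wE//.
  by rewrite 2!bopM (liftE _ _ r1H Nx).
have finP : trace_fin t tau e (lift r1 id + lift f0 id).
  exact: (trace_finD tT Mvn tauP (inA _ r1H) (inA _ f0H) (fin _ r1H)
    (fin _ f0H)).
have [U [AU UU UU' UE]] := cancellation_core tT Mf tauP Nvn eB
  (lift_bop_hom r1H) (lift_bop_hom f0H) (lift_bop_hom r3H) (lift_bop_hom g3H)
  rfE Aw ww r3E (lift_orthogonal r1H f0H o1) (lift_orthogonal r3H g3H o3) finP.
(* The chain is [f0], [g3], [g2], [g0]; its first link is the unitary [U]. *)
apply: (conj_equiv_trans S0s (pi2 := g3)).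
  apply: (conj_equiv_sym S0s); apply/conj_equivP; exists U => // x Nx.
  rewrite -(liftE _ _ g3H Nx) UE// /conj_hom -(liftE _ _ f0H Nx).
  by [].
by apply: (conj_equiv_trans S0s (conj_hom_equiv N g2 uU)).
Qed.

End HomAddition.

Theorem proposition9 (R : realType) (G K H L : hilbertType R)
    (N : set (G -> G)) (M : set (K -> K)) (tau : (K -> K) -> R[i])
    (t : H -> K -> L) :
  II1_factor N ->
  II1_factor M ->
  faithful_normal_tracial_state M tau ->
  separable_space H ->
  infinite_dimensional [set: H] ->
  hilbert_tensor t ->
  let A := amplification t M in
  let Minf := finite_trace_ideal t M tau in
  forall rho phi psi : set ((G -> G) -> (L -> L)),
    hom_space N A Minf rho -> hom_space N A Minf phi -> hom_space N A Minf psi ->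
    hom_add N A Minf rho phi = hom_add N A Minf rho psi -> phi = psi.
Proof.
move=> [[Nvn _] _ _] [Mf _ _] tauP _ _ tT A Minf rho phi psi.
exact: (hom_space_cancel tT Mf tauP Nvn).
Qed.
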